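(* Every fixed $\mathsf{WRP}$ map $T\colon\Sigma^*\rightharpoonup\Gamma^*$ having a presentation of arity $k$ is computable in deterministic logarithmic space: on an input $w$ of length $n$, an evaluator uses only $O(\log n)$ bits of working memory beyond a read-only input and a write-only output. Its output has length $|T(w)|=O(n^k)$ and is produced in polynomial time. (The implied constants depend only on the fixed presentation.)
   Context: **MSO on words.** A word $w=a_1\cdots a_n$ over a finite alphabet $\Sigma$ is a structure with universe $\mathrm{Pos}(w)=\{1,\dots,n\}$, the order $<$, and unary predicates $P_a$ ($a\in\Sigma$) with $P_a(i)$ iff $a_i=a$. MSO formulas are built from $x<y$, $x=y$, $P_a(x)$, $x\in X$ by Boolean connectives and quantification over positions and over sets of positions. $w\models\varphi(i_1,\dots,i_k)$ denotes satisfaction. **Polyregular presentations.** A polyregular presentation (input alphabet $\Sigma$, output alphabet $\Gamma$, both finite) consists of: a nonempty finite set $C$ of copy names, each $c\in C$ with an arity $k_c\ge1$; an MSO domain sentence $\varphi_{\mathrm{dom}}$; for each $c$ an MSO selection formula $\varphi_c(x_1,\dots,x_{k_c})$, giving the set of selected atoms $\mathrm{At}(w)=\{(c,\bar i):c\in C,\ \bar i\in\mathrm{Pos}(w)^{k_c},\ w\models\varphi_c(\bar i)\}$; for each $c$ and $\gamma\in\Gamma$ an MSO label formula $\psi_{c,\gamma}(x_1,\dots,x_{k_c})$ such that each selected atom $(c,\bar i)$ satisfies exactly one of them, that $\gamma$ being its label; and for each pair $c,c'\in C$ an MSO ordering formula $\chi_{c,c'}(\bar x,\bar y)$, such that on each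 $w$ these define a strict linear order $\chi$ on $\mathrm{At}(w)$. The arity of the presentation is $\max_c k_c$. **Rank functions.** A $d$-dimensional deterministic additive rank source over $\Sigma$ is $A=(Q,q_0,\delta,\omega)$ with $Q$ a finite set, $q_0\in Q$, $\delta\colon Q\times\Sigma\to Q$, $\omega\colon Q\times\Sigma\to\mathbb Z^d$. On $w=a_1\cdots a_n$ put $q_i=\delta(q_{i-1},a_i)$; for $1\le i\le n+1$ the prefix rank is $\rho_A^w(i)=\sum_{j<i}\omega(q_{j-1},a_j)$, and $q^A_i:=q_{i-1}$ is the state just before position $i$. A $d$-dimensional prefix-additive rank function on $k$-tuples of positions is a function of the form $\kappa^w(x_1,\dots,x_k)=c_0+\sum_{r=1}^k\bigl(\rho_{A_r}^w(x_r)+\beta_r(q^{A_r}_{x_r},a_{x_r})\bigr)$, with $c_0\in\mathbb Z^d$ fixed, $A_r$ fixed $d$-dimensional rank sources with state sets $Q_r$, and $\beta_r\colon Q_r\times\Sigma\to\mathbb Z^d$ fixed tables. **WRP.** A $\mathsf{WRP}$ presentation is a polyregular presentation together with a fixed $d\ge0$ and, for each $c\in C$, a $d$-dimensional prefix-additive rank function $\kappa_c$ on $k_c$-tuples. Selected atoms are ordered by $(c,\bar i)\prec(c',\bar i')$ iff $\kappa_c^w(\bar i)<_{\mathrm{lex}}\kappa_{c'}^w(\bar i')$, or these vectors are equal and $(c,\bar i)$ precedes $(c',\bar i')$ in $\chi$. The associated partial map $T\colon\Sigma^*\rightharpoonup\Gamma^*$ has domain $\{w:w\models\varphi_{\mathrm{dom}}\}$,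 and $T(w)$ is the concatenation of the labels of the selected atoms in increasing $\prec$-order. $\mathsf{WRP}$ is the class of partial maps so obtained. **Logspace evaluators.** A deterministic logarithmic-space evaluator is a deterministic algorithm (e.g. a Turing machine) with read-only access to the input, a write-only output, and a work tape using $O(\log n)$ bits on inputs of length $n$ (with the usual convention that $\log n$ is replaced by $\max(1,\log n)$ for small $n$). Space is measured in bits. It computes a partial map $T$ if on every $w\in\operatorname{dom}(T)$ it halts having written $T(w)$, and on $w\notin\operatorname{dom}(T)$ it reports that $T(w)$ is undefined. *)

(* Defs.v *)
From HB Require Import structures.
From mathcomp Require Import all_boot all_order all_algebra.

Set Implicit Arguments.
Unset Strict Implicit.
Unset Printing Implicit Defensive.

(** * MSO on words

    A word is [w : seq S]; its positions are ['I_(size w)], counted from 0.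
    [mso S k m] is the type of formulas with [k] free position variables and
    [m] free set variables (de Bruijn indices: a quantifier binds the variable
    of index 0 and shifts the others). *)

Inductive mso (S : finType) : nat -> nat -> Type :=
| MLt k m of 'I_k & 'I_k : mso S k m
| MEq k m of 'I_k & 'I_k : mso S k m
| MLetter k m of S & 'I_k : mso S k m
| MIn k m of 'I_k & 'I_m : mso S k m
| MNot k m of mso S k m : mso S k m
| MAnd k m of mso S k m & mso S k m : mso S k m
| MOr k m of mso S k m & mso S k m : mso S k m
| MExPos k m of mso S k.+1 m : mso S k m
| MAllPos k m of mso S k.+1 m : mso S k m
| MExSet k m of mso S k m.+1 : mso S k m
| MAllSet k m of mso S k m.+1 : mso S k m.

Definition letter (S : finType) (w : seq S) (i : 'I_(size w)) : S :=
  tnth (in_tuple w) i.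

Fixpoint msat (S : finType) (w : seq S) (k m : nat) (phi : mso S k m) :
    k.-tuple 'I_(size w) -> m.-tuple {set 'I_(size w)} -> bool :=
  match phi in mso _ k m
    return k.-tuple 'I_(size w) -> m.-tuple {set 'I_(size w)} -> bool with
  | MLt _ _ x y => fun v V => tnth v x < tnth v y
  | MEq _ _ x y => fun v V => tnth v x == tnth v y
  | MLetter _ _ a x => fun v V => letter (tnth v x) == a
  | MIn _ _ x X => fun v V => tnth v x \in tnth V X
  | MNot _ _ f => fun v V => ~~ msat f v V
  | MAnd _ _ f g => fun v V => msat f v V && msat g v V
  | MOr _ _ f g => fun v V => msat f v V || msat g v V
  | MExPos _ _ f => fun v V => [exists i, msat f (cons_tuple i v) V]
  | MAllPos _ _ f => fun v V => [forall i, msat f (cons_tuple i v) V]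
  | MExSet _ _ f => fun v V => [exists X, msat f v (cons_tuple X V)]
  | MAllSet _ _ f => fun v V => [forall X, msat f v (cons_tuple X V)]
  end.

(** [w |= phi(i_1, ..., i_k)], for [phi] without free set variables. *)
Definition holds (S : finType) (w : seq S) (k : nat) (phi : mso S k 0)
  (v : k.-tuple 'I_(size w)) : bool := msat phi v [tuple].

(** * Polyregular presentations *)

Record poly_data (S G : finType) := PolyData {
  copy : finType;
  ar : copy -> nat;
  dom_formula : mso S 0 0;
  sel_formula : forall c, mso S (ar c) 0;
  lab_formula : forall c, G -> mso S (ar c) 0;
  ord_formula : forall c c', mso S (ar c + ar c') 0
}.

Section Atoms.
Variables (S G : finType) (D : poly_data S G) (w : seq S).

Definition atom : finType := {c : copy D & (ar c).-tuple 'I_(size w)}.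

Definition selected (a : atom) : bool :=
  holds (sel_formula (tag a)) (tagged a).

Definition has_label (a : atom) (g : G) : bool :=
  holds (lab_formula (tag a) g) (tagged a).

Definition chi (a b : atom) : bool :=
  holds (ord_formula (tag a) (tag b)) (cat_tuple (tagged a) (tagged b)).

End Atoms.

Definition strict_linear_on (T : finType) (A : {pred T}) (r : rel T) : Prop :=
  [/\ {in A, forall x, ~~ r x x},
      {in A & &, forall y x z, r x y -> r y z -> r x z} &
      {in A &, forall x y, x != y -> r x y || r y x}].

Record poly_pres (S G : finType) := PolyPres {
  pp_data :> poly_data S G;
  copy_nonempty : 0 < #|copy pp_data|;
  ar_gt0 : forall c : copy pp_data, 0 < ar c;
  label_unique : forall (w : seq S) (a : atom pp_data w),
    selected a -> exists! g, has_label a g;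
  chi_linear : forall w : seq S,
    strict_linear_on (@selected _ _ pp_data w) (@chi _ _ pp_data w)
}.

Definition arity (S G : finType) (P : poly_pres S G) : nat :=
  \max_(c : copy P) ar c.

(** * Rank functions *)

Record rank_source (S : finType) (d : nat) := RankSource {
  rs_state : finType;
  rs_init : rs_state;
  rs_step : rs_state -> S -> rs_state;
  rs_weight : rs_state -> S -> 'rV[int]_d
}.

(** State just before the 0-based position [i]. *)
Definition state_before (S : finType) (d : nat) (A : rank_source S d)
  (w : seq S) (i : nat) : rs_state A :=
  foldl (@rs_step _ _ A) (rs_init A) (take i w).

Definition prefix_rank (S : finType) (d : nat) (A : rank_source S d)
  (w : seq S) (i : nat) : 'rV[int]_d :=
  (\sum_(j < size w | (j < i)%N) rs_weight (state_before A w j) (letter j))%R.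

Record rank_fun (S : finType) (d k : nat) := RankFun {
  rf_const : 'rV[int]_d;
  rf_source : 'I_k -> rank_source S d;
  rf_table : forall r, rs_state (rf_source r) -> S -> 'rV[int]_d
}.

Definition rank_val (S : finType) (d k : nat) (f : rank_fun S d k)
  (w : seq S) (x : k.-tuple 'I_(size w)) : 'rV[int]_d :=
  (rf_const f + \sum_(r < k)
     (prefix_rank (rf_source f r) w (tnth x r) +
      rf_table (state_before (rf_source f r) w (tnth x r))
               (letter (tnth x r))))%R.

(** * WRP presentations *)

Record wrp_pres (S G : finType) := WrpPres {
  wp_poly :> poly_pres S G;
  wp_dim : nat;
  wp_rank : forall c : copy wp_poly, rank_fun S wp_dim (ar c)
}.

Definition lex_lt (d : nat) (u v : 'rV[int]_d) : bool :=
  (([tuple u ord0 i | i < d] : d.-tuplelexi int)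
     < ([tuple v ord0 i | i < d] : d.-tuplelexi int))%O.

Section WrpMap.
Variables (S G : finType) (P : wrp_pres S G) (w : seq S).

Definition kappa (a : atom P w) : 'rV[int]_(wp_dim P) :=
  rank_val (wp_rank (tag a)) (tagged a).

Definition prec (a b : atom P w) : bool :=
  lex_lt (kappa a) (kappa b) || (kappa a == kappa b) && chi a b.

(** [sort] expects a reflexive order, hence the reflexive closure of [prec]. *)
Definition sorted_atoms : seq (atom P w) :=
  sort (fun a b => (a == b) || prec a b) (enum (@selected _ _ P w)).

Definition label (a : atom P w) : option G := [pick g | has_label a g].

(** [pmap] drops nothing: selected atoms have a label by [label_unique]. *)
Definition wrp_map : option (seq G) :=
  if holds (w := w) (dom_formula P) [tuple] then Some (pmap label sorted_atoms)
  else None.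

End WrpMap.

(** * Deterministic Turing machines with read-only input, one two-way infinite
    work tape and write-only output *)

(** The input tape carries [w] between two end markers. *)
Inductive insym (S : Type) := LeftEnd | RightEnd | Letter of S.
Arguments LeftEnd {S}.
Arguments RightEnd {S}.

Inductive move := MoveL | Stay | MoveR.

(** [Step q b mi mw o]: enter state [q], write [b] on the work tape, move the
    input head by [mi] and the work head by [mw], append [o] (if any) to the
    output. [Reject] reports that the value is undefined. *)
Inductive instr (G Q B : Type) :=
| Accept
| Reject
| Step of Q & B & move & move & option G.
Arguments Accept {G Q B}.
Arguments Reject {G Q B}.

Record machine (S G : finType) := Machine {
  tm_state : finType;
  tm_work : finType;
  tm_blank : tm_work;
  tm_init : tm_state;
  tm_instr : tm_state -> insym S -> tm_work -> instr G tm_state tm_work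
}.

(** The work tape is a zipper holding exactly the cells visited so far:
    [c_left] lists those to the left of the head and [c_right] those to its
    right, both starting next to the head. *)
Record config (G Q B : Type) := Config {
  c_state : Q;
  c_input : nat;
  c_left : seq B;
  c_head : B;
  c_right : seq B;
  c_output : seq G
}.

Definition read_input (S : finType) (w : seq S) (p : nat) : insym S :=
  if p is i.+1 then
    if onth w i is Some a then Letter a else RightEnd
  else LeftEnd.

(** The input head stays within the cells [0 .. n + 1]. *)
Definition move_input (n : nat) (mv : move) (p : nat) : nat :=
  match mv with MoveL => p.-1 | Stay => p | MoveR => minn p.+1 n.+1 end.

Definition move_work (B : Type) (blank : B) (mv : move)
  (l : seq B) (b : B) (r : seq B) : seq B * B * seq B :=
  match mv with
  | MoveL => (behead l, head blank l, b :: r)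
  | Stay => (l, b, r)
  | MoveR => (b :: l, head blank r, behead r)
  end.

Section Run.
Variables (S G : finType) (M : machine S G) (w : seq S).

Let cfg := config G (tm_state M) (tm_work M).

Definition current_instr (c : cfg) : instr G (tm_state M) (tm_work M) :=
  tm_instr (c_state c) (read_input w (c_input c)) (c_head c).

Definition next (c : cfg) : cfg :=
  if current_instr c is Step q b mi mw o then
    let: (l, h, r) := move_work (tm_blank M) mw (c_left c) b (c_right c) in
    Config q (move_input (size w) mi (c_input c)) l h r
           (c_output c ++ (if o is Some g then [:: g] else [::]))
  else c.

Definition start : cfg := Config (tm_init M) 0 [::] (tm_blank M) [::] [::].

Definition run (t : nat) : cfg := iter t next start.

(** [None] while the computation is still going on. *)
Definition verdict (c : cfg) : option bool :=
  match current_instr c with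
  | Accept => Some true
  | Reject => Some false
  | Step _ _ _ _ _ => None
  end.

(** Work space in bits. A visited cell is charged at least one bit, even if
    the work alphabet has a single symbol. *)
Definition space (c : cfg) : nat :=
  (size (c_left c) + size (c_right c)).+1 * maxn 1 (up_log 2 #|tm_work M|).

End Run.

Definition computes (S G : finType) (M : machine S G)
  (T : seq S -> option (seq G)) : Prop :=
  forall w, exists t,
    if T w is Some u then
      verdict w (run M w t) = Some true /\ c_output (run M w t) = u
    else verdict w (run M w t) = Some false.

Definition log_space (S G : finType) (M : machine S G) : Prop :=
  exists C, forall w t,
    space (run M w t) <= C * maxn 1 (trunc_log 2 (size w)).

Definition poly_time (S G : finType) (M : machine S G) : Prop :=
  exists C e, forall w, exists2 t,
    t <= C * (size w).+1 ^ e & verdict w (run M w t) <> None.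

(* Main.v *)
Require Import Defs.
From mathcomp Require Import all_boot all_order all_algebra.
From mathcomp Require Import zify ring.

Set Implicit Arguments.
Unset Strict Implicit.
Unset Printing Implicit Defensive.
Import Order.TTheory GRing.Theory Num.Theory.

(** Write [n] for the length of the input [w]. The selected atoms are strictly
    linearly ordered by [prec], so the output can be written by successor
    search: given the current atom, run over all atoms and keep the least
    selected one above it, write its label, make it current, and stop when
    there is none ([next_atom], [wp_main_loop]). This needs three atoms at a
    time, that is, boundedly many positions, hence O(log n) bits.

    Every test made by the search is a fixed number of sweeps over the input
    with finite control and bounded counters. Selection, labels and the order
    [chi] are given by fixed MSO formulas, and a fixed formula is a finite
    automaton reading the word together with marks for its free variables
    ([mso_dfaP]); the marks are obtained by comparing the current position with
    the stored ones. A coordinate of a rank is a constant plus finitely many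
    prefix sums of bounded weights, so it is O(n) in absolute value. Two ranks
    are compared one coordinate at a time, by accumulating the difference of the
    two values as a difference of two natural counters ([cmp_rankP]).

    The machine is assembled from control fragments closed under sequencing and
    iteration ([bind], [loop]). Its work tape carries all registers as parallel
    binary tracks, and each register operation is one left-to-right pass of a
    finite transducer ([pass_runs]). Only an increment that overflows lengthens
    the tape, so as long as all values stay below [2 ^ W] at most [W] cells
    carry digits ([wp_incr]), and [W] can be taken to be log n plus a constant.

    Neither time nor space has to be tracked along the way. Cells once visited
    stay charged, so the space of the final configuration bounds the space of
    the whole run ([space_run_halted]); and a deterministic machine that halts
    repeats no configuration before, so logarithmic space implies polynomial
    time ([poly_time_of_log_space]). The output length is bounded by the number of
    atoms ([wrp_map_size]). *)

(** * Space and time of halting machines *)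

Lemma leq_exp2 m n e : m <= n -> m ^ e <= n ^ e.
Proof. by case: e => // e mn; rewrite leq_exp2r. Qed.

Section MachineBounds.
Variables (S G : finType) (M : machine S G) (w : seq S).

Lemma size_move_work (B : Type) (blank : B) mv l b r :
  let: (l', _, r') := move_work blank mv l b r in
  size l + size r <= size l' + size r'.
Proof. by case: mv => /=; rewrite ?size_behead; lia. Qed.

Lemma run_add t u : run M w (t + u) = iter u (Defs.next w) (run M w t).
Proof. by rewrite /run addnC iterD. Qed.

Lemma next_halted (c : config G (tm_state M) (tm_work M)) :
  verdict w c <> None -> Defs.next w c = c.
Proof. by rewrite /verdict /Defs.next; case: (current_instr w c). Qed.

Lemma run_halted t u : verdict w (run M w t) <> None -> t <= u ->
  run M w u = run M w t.
Proof.
move=> ht /subnKC <-; rewrite run_add.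
by elim: (u - t) => //= k ->; apply: next_halted.
Qed.

Lemma space_run_le t u : t <= u -> Defs.space (run M w t) <= Defs.space (run M w u).
Proof.
have step (c : config G (tm_state M) (tm_work M)) :
    Defs.space c <= Defs.space (Defs.next w c).
  rewrite /Defs.space leq_mul2r /Defs.next; case: (current_instr w c) => [||q b mi mw o];
    rewrite ?leqnn ?orbT //.
  have := size_move_work (tm_blank M) mw (c_left c) b (c_right c).
  by case: (move_work _ _ _ _ _) => [[l h] r] /= hs; rewrite ltnS hs orbT.
by move/subnKC <-; rewrite run_add; elim: (u - t) => //= k /leq_trans; apply.
Qed.

Lemma space_run_halted t u : verdict w (run M w t) <> None ->
  Defs.space (run M w u) <= Defs.space (run M w t).
Proof.
move=> ht; case: (leqP u t) => [/space_run_le //|/ltnW htu].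
by rewrite (run_halted ht htu).
Qed.

Lemma input_run_le t : c_input (run M w t) <= (size w).+1.
Proof.
elim: t => //= t IH; rewrite /Defs.next; case: (current_instr _ _) => // q b mi mw o.
case: (move_work _ _ _ _ _) => [[l h] r] /=.
by case: mi => //=; [apply: leq_trans IH; apply: leq_pred | apply: geq_minr].
Qed.

(** What determines the future of a computation: everything but the output,
    which is never read. *)
Definition core (c : config G (tm_state M) (tm_work M)) :=
  (c_state c, c_input c, c_left c, c_head c, c_right c).

Lemma core_next c c' : core c = core c' -> core (Defs.next w c) = core (Defs.next w c').
Proof.
case: c c' => [q p l h r o] [q' p' l' h' r' o'] [-> -> -> -> ->].
rewrite /Defs.next /current_instr /=; case: (tm_instr _ _ _) => // q1 b mi mw x.
by case: (move_work _ _ _ _ _) => [[l1 h1] r1].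
Qed.

Lemma core_iter n c c' : core c = core c' ->
  core (iter n (Defs.next w) c) = core (iter n (Defs.next w) c').
Proof. by move=> h; elim: n => //= n; apply: core_next. Qed.

Lemma core_verdict c c' : core c = core c' -> verdict w c = verdict w c'.
Proof. by case: c c' => [q p l h r o] [q' p' l' h' r' o'] [-> -> -> -> ->]. Qed.

(** If moments [i < j] before the first halting time [t] had the same core, the
    run would halt [t - j] steps after [i] as well, that is, before [t]. *)
Lemma core_run_inj t i j :
  (forall u, verdict w (run M w u) <> None -> t <= u) ->
  verdict w (run M w t) <> None ->
  i < t -> j < t -> core (run M w i) = core (run M w j) -> i = j.
Proof.
move=> tmin ht; wlog lt_ij : i j / i < j => [th|] hi hj e.
  by case: (ltngtP i j) => // h; [|symmetry]; apply: th.
have := core_iter (t - j) e; rewrite -!run_add subnKC 1?ltnW // => e'.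
by have := tmin (i + (t - j)); rewrite (core_verdict e') => /(_ ht); lia.
Qed.

(** Pigeonhole: the cores seen before halting are pairwise distinct, and a core
    is determined by a state, an input position, a letter and two words of
    length at most [L]. *)
Lemma halting_time_le t L :
  verdict w (run M w t) <> None ->
  (forall u, size (c_left (run M w u)) + size (c_right (run M w u)) <= L) ->
  exists2 t', t' <= #|tm_state M| * (size w).+2 * #|tm_work M| *
                    (#|tm_work M|.+1 ^ L * #|tm_work M|.+1 ^ L) &
              verdict w (run M w t') <> None.
Proof.
move=> ht hL.
have ex : exists u, verdict w (run M w u) != None by exists t; apply/eqP.
case: (ex_minnP ex) => {ht}t /eqP ht tmin; exists t => //.
(* A word of length at most [L] is padded with [None] to a tuple. *)
pose pad (l : seq (tm_work M)) : L.-tuple (option (tm_work M)) :=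
  [tuple onth l i | i < L].
pose f (i : 'I_t) :=
  let c := run M w i in
  (c_state c, inord (c_input c) : 'I_(size w).+2, c_head c,
   (pad (c_left c), pad (c_right c))).
have pad_inj l l' : size l <= L -> size l' <= L -> pad l = pad l' :> seq _ -> l = l'.
  move=> hl hl' /val_inj /eqP; rewrite eqEtuple => /forallP e.
  apply: eq_from_onth => i; case: (ltnP i L) => hi.
    by have := e (Ordinal hi); rewrite !tnth_mktuple => /eqP.
  by rewrite !onth_default // (leq_trans _ hi).
have f_inj : injective f.
  move=> i j [e1 /(congr1 val) e2 e3 e4 e5]; apply: ord_inj.
  apply: (core_run_inj (t := t)) => //.
    by move=> u hu; apply: tmin; apply/eqP.
  move: e2; rewrite /= !inordK ?ltnS ?input_run_le // => e2.
  have [li ri] : size (c_left (run M w i)) <= L /\ size (c_right (run M w i)) <= L.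
    by split; apply: leq_trans (hL i); rewrite ?leq_addr ?leq_addl.
  have [lj rj] : size (c_left (run M w j)) <= L /\ size (c_right (run M w j)) <= L.
    by split; apply: leq_trans (hL j); rewrite ?leq_addr ?leq_addl.
  by rewrite /core e1 e2 e3 (pad_inj _ _ li lj e4) (pad_inj _ _ ri rj e5).
have := leq_card f f_inj.
by rewrite card_ord !card_prod card_ord !card_tuple card_option.
Qed.

End MachineBounds.

(** With [L] at most [C * log n], the exponential count of work tapes in
    [halting_time_le] is polynomial. *)
Lemma poly_time_of_log_space (S G : finType) (M : machine S G) :
  (forall w, exists t, verdict w (run M w t) <> None) ->
  log_space M -> poly_time M.
Proof.
move=> halts [C hC].
set b := #|tm_work M|.+1; pose e := up_log 2 b.
have hb : b <= 2 ^ e by exact: (@up_logP 2 b isT).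
exists (#|tm_state M| * 2 * #|tm_work M| * 4 ^ (e * C)), (1 + (e * C).*2) => w.
have [t ht] := halts w.
set m := maxn 1 (trunc_log 2 (size w)).
have hL u : size (c_left (run M w u)) + size (c_right (run M w u)) <= C * m.
  apply: leq_trans (hC w u); rewrite /Defs.space; apply: leq_trans (leqnSn _) _.
  by rewrite leq_pmulr // leq_max.
have [t' le_t' ht'] := halting_time_le ht hL; exists t' => //.
apply: leq_trans le_t' _.
have hm : 2 ^ m <= 2 * (size w).+1.
  rewrite /m /maxn; case: ifP => h; last by lia.
  have [->|n0] := posnP (size w); first by rewrite trunc_log0.
  by have := trunc_logP (leqnn 2) n0; lia.
have hbL : b ^ (C * m) <= (2 * (size w).+1) ^ (e * C).
  apply: leq_trans (leq_exp2 _ hb) _.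
  rewrite -expnM mulnA mulnC expnM; exact: leq_exp2.
rewrite -/b expnD expn1 -addnn expnD.
have -> : 4 ^ (e * C) = 2 ^ (e * C) * 2 ^ (e * C) by rewrite -expnMn.
rewrite expnMn in hbL.
set A := 2 ^ (e * C) in hbL *; set N := (size w).+1 ^ (e * C) in hbL *.
apply: (@leq_trans (#|tm_state M| * (2 * (size w).+1) * #|tm_work M| *
                      (A * N * (A * N)))).
  by apply: leq_mul; [rewrite !leq_mul2r leq_mul2l; lia | apply: leq_mul].
by apply: eq_leq; ring.
Qed.

(** * Structured control *)

Section Fragments.
Variables (S G B : finType) (blank : B).

(** A configuration without its state, so that fragments with different state
    sets act on the same data. *)
Record store := Store {
  st_input : nat;
  st_left : seq B;
  st_head : B;
  st_right : seq B;
  st_output : seq G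
}.

Definition action := (B * move * move * option G)%type.

Definition act_on (n : nat) (x : action) (s : store) : store :=
  let: (b, mi, mw, o) := x in
  let: (l, h, r) := move_work blank mw (st_left s) b (st_right s) in
  Store (move_input n mi (st_input s)) l h r
        (st_output s ++ (if o is Some g then [:: g] else [::])).

(** A piece of finite control: it starts in [fr_init] and may leave with a
    value of the finite type [A]. Values passed on by [bind] and [loop] thus live
    in the control state and cost no work tape. *)
Record frag (A : finType) := Frag {
  fr_state : finType;
  fr_init : fr_state;
  fr_step : fr_state -> insym S -> B -> (fr_state + A) * action
}.

Definition act (A : finType) (f : insym S -> B -> A * action) : frag A :=
  @Frag A unit tt (fun _ x b => let: (a, y) := f x b in (inr a, y)).

Definition ret (A : finType) (a : A) : frag A :=
  act (fun _ b => (a, (b, Stay, Stay, None))).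

(** The states of the second part are tagged with the value handed over, so
    that each of these values has its own copy of the control. *)
Definition bind (A A' : finType) (m : frag A) (k : A -> frag A') : frag A' :=
  @Frag A' (fr_state m + {a : A & fr_state (k a)})%type (inl (fr_init m))
    (fun q x b => match q with
     | inl q => let: (q', y) := fr_step q x b in
         (inl (match q' with
               | inl q' => inl q'
               | inr a => inr (Tagged (fun a => fr_state (k a)) (fr_init (k a)))
               end), y)
     | inr q => let: (q', y) := fr_step (tagged q) x b in
         (match q' with
          | inl q' => inl (inr (Tagged (fun a => fr_state (k a)) q'))
          | inr a => inr a
          end, y)
     end).

(** Exit values [inl a'] start a new round with [f a'], exit values [inr a']
    leave the loop. *)
Definition loop (A A' : finType) (f : A -> frag (A + A')%type) (a : A) :
    frag A' :=
  @Frag A' {a : A & fr_state (f a)}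
    (Tagged (fun a => fr_state (f a)) (fr_init (f a)))
    (fun q x b => let: (q', y) := fr_step (tagged q) x b in
         (match q' with
          | inl q' => inl (Tagged (fun a => fr_state (f a)) q')
          | inr (inl a') => inl (Tagged (fun a => fr_state (f a)) (fr_init (f a')))
          | inr (inr a') => inr a'
          end, y)).

Variable w : seq S.

Section Steps.
Variables (A Q : finType) (step : Q -> insym S -> B -> (Q + A) * action).

Definition fr_next (q : Q) (s : store) :=
  let: (q', y) := step q (read_input w (st_input s)) (st_head s) in
  (q', act_on (size w) y s).

(** This depends on the step function alone: fragments [loop f a] with different
    [a] share their steps, so a run of one may continue as a run of another. *)
Inductive runs_from : Q -> store -> A -> store -> Prop :=
| RunsDone q s a s' : fr_next q s = (inr a, s') -> runs_from q s a s'
| RunsStep q s q' s' a s'' : fr_next q s = (inl q', s') ->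
    runs_from q' s' a s'' -> runs_from q s a s''.

End Steps.

Definition runs (A : finType) (p : frag A) :=
  runs_from (@fr_step A p) (fr_init p).

Lemma runs_act (A : finType) (f : insym S -> B -> A * action) s a y :
  f (read_input w (st_input s)) (st_head s) = (a, y) ->
  runs (act f) s a (act_on (size w) y s).
Proof. by move=> e; apply: RunsDone; rewrite /fr_next /= e. Qed.

Lemma runs_ret (A : finType) (a : A) s : runs (ret a) s a s.
Proof. by apply: RunsDone; rewrite /fr_next /act_on /= cats0; case: s. Qed.

Lemma runs_bind (A A' : finType) (m : frag A) (k : A -> frag A') s a s' a' s'' :
  runs m s a s' -> runs (k a) s' a' s'' -> runs (bind m k) s a' s''.
Proof.
rewrite /runs [fr_init (bind m k)]/= => hm hk.
have step_inl q t q' t' : fr_next (@fr_step A m) q t = (q', t') ->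
    fr_next (@fr_step A' (bind m k)) (inl q) t =
      (inl (match q' with
            | inl q' => inl q'
            | inr a => inr (Tagged (fun a => fr_state (k a)) (fr_init (k a)))
            end), t').
  by rewrite /fr_next /=; case: (fr_step _ _ _) => ? ? [-> ->].
elim: hm hk => {s a s'} [q s a s' e|q s q' s' a s1 e _ IH] hk; last first.
  exact: RunsStep (step_inl _ _ _ _ e) (IH hk).
apply: RunsStep (step_inl _ _ _ _ e) _.
elim: hk => {q s s' a' s'' e} [q s a1 s' e|q s q' s' a1 s1 e _ IH].
  apply: RunsDone.
  by move: e; rewrite /fr_next /=; case: (fr_step _ _ _) => ? ? [-> ->].
apply: (RunsStep _ IH).
by move: e; rewrite /fr_next /=; case: (fr_step _ _ _) => ? ? [-> ->].
Qed.

Lemma runs_from_loop (A A' : finType) (f : A -> frag (A + A')%type) a0 q s r s' :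
  runs_from (@fr_step _ (f a0)) q s r s' ->
  forall a' s'',
  match r with
  | inl a => runs (loop f a) s' a' s''
  | inr a => a' = a /\ s'' = s'
  end ->
  runs_from (@fr_step _ (loop f a0)) (Tagged (fun a => fr_state (f a)) q) s a' s''.
Proof.
elim=> {q s r s'} [q s r s' e|q s q' s' r s1 e _ IH] a' s'' h; last first.
  apply: (RunsStep _ (IH _ _ h)).
  by move: e; rewrite /fr_next /=; case: (fr_step _ _ _) => ? ? [-> ->].
case: r e h => [a|a] e h.
  apply: (RunsStep _ h).
  by move: e; rewrite /fr_next /=; case: (fr_step _ _ _) => ? ? [-> ->].
case: h => -> ->; apply: RunsDone.
by move: e; rewrite /fr_next /=; case: (fr_step _ _ _) => ? ? [-> ->].
Qed.

Lemma runs_loop_next (A A' : finType) (f : A -> frag (A + A')%type)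
    a s a1 s1 a' s' :
  runs (f a) s (inl a1) s1 -> runs (loop f a1) s1 a' s' ->
  runs (loop f a) s a' s'.
Proof. by move=> h h'; apply: (runs_from_loop h). Qed.

Lemma runs_loop_exit (A A' : finType) (f : A -> frag (A + A')%type) a s a' s' :
  runs (f a) s (inr a') s' -> runs (loop f a) s a' s'.
Proof. by move=> h; apply: (runs_from_loop h). Qed.

End Fragments.

Arguments ret {S G B A} a.

Section Compile.
Variables (S G B : finType) (blank : B) (p : frag S G B bool).

Definition frag_machine : machine S G :=
  @Machine S G (fr_state p + bool)%type B blank (inl (fr_init p))
    (fun q x b => match q with
     | inl q => let: (q', (b', mi, mw, o)) := fr_step q x b in
                Step q' b' mi mw o
     | inr true => Accept
     | inr false => Reject
     end).

Lemma frag_machine_run w a s' :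
  runs blank w p (Store 0 [::] blank [::] [::]) a s' ->
  exists t, let c := run frag_machine w t in
  [/\ verdict w c = Some a, c_output c = st_output s' &
      Defs.space c =
      (size (st_left s') + size (st_right s')).+1 * maxn 1 (up_log 2 #|B|)].
Proof.
pose cf (q : fr_state p + bool) (s : store G B) : config G (tm_state frag_machine) B :=
  Config (q : tm_state frag_machine) (st_input s) (st_left s) (st_head s)
    (st_right s) (st_output s).
have step q s q' s1 : fr_next blank w (@fr_step _ _ _ _ p) q s = (q', s1) ->
    Defs.next (M := frag_machine) w (cf (inl q) s) = cf q' s1.
  rewrite /fr_next /Defs.next /current_instr /=.
  case: (fr_step _ _ _) => q1 [[[b mi] mw] o] [<- <-] /=.
  by case: (move_work _ _ _ _ _) => [[l h] r].
suff gen q s : runs_from blank w (@fr_step _ _ _ _ p) q s a s' ->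
    exists t, iter t (Defs.next w) (cf (inl q) s) = cf (inr a) s'.
  move/gen => [t e]; exists t; rewrite /run /start.
  rewrite [Config _ _ _ _ _ _](_ : _ = cf (inl (fr_init p))
    (Store 0 [::] blank [::] [::])) //.
  by rewrite e; split => //; rewrite /verdict /current_instr /=; case: (a).
elim=> {q s a s'} [q s a s' e|q s q' s' a s1 e _ [t IH]].
  by exists 1; apply: step.
by exists t.+1; rewrite iterSr (step _ _ _ _ e).
Qed.

End Compile.

(** * Registers as binary tracks of the work tape *)

Section Tracks.
Variable R : finType.

(** One binary digit of each register. *)
Definition cell : finType := {ffun R -> bool}.

(** [None] is the blank; [Some None] is a mark at the left end of the digits,
    which allows the head to find its way back. *)
Definition work_sym : finType := option (option cell).

(** The cell next to the mark holds the least significant digits, the order in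
    which a left-to-right pass propagates carries. *)
Fixpoint value (cs : seq cell) (j : R) : nat :=
  if cs is c :: cs' then c j + (value cs' j).*2 else 0.

(** A pass visits the cell behind the last digit, so up to one visited blank
    ([e <= 1]) may follow the digits. *)
Definition tape_of (cs : seq cell) e : seq work_sym :=
  map (fun c => Some (Some c)) cs ++ nseq e None.

Lemma tape_rcons cs c :
  tape_of (rcons cs c) 0 = rcons (tape_of cs 0) (Some (Some c)).
Proof. by rewrite /tape_of map_rcons !cats0. Qed.

Lemma value_cat cs cs' j :
  value (cs ++ cs') j = value cs j + 2 ^ size cs * value cs' j.
Proof.
elim: cs => [|c cs IH] /=; first by rewrite mul1n.
by rewrite IH expnS doubleD -!mul2n !mulnA addnA.
Qed.

Section Mealy.
Variables (Q : finType) (delta : Q -> cell -> Q * cell).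

Fixpoint mealy (q : Q) (cs : seq cell) : Q * seq cell :=
  if cs is c :: cs' then
    let: (q', c') := delta q c in
    let: (q'', cs'') := mealy q' cs' in (q'', c' :: cs'')
  else (q, [::]).

Lemma size_mealy q cs : size (mealy q cs).2 = size cs.
Proof.
elim: cs q => //= c cs IH q; case: (delta q c) => q' c'.
by have := IH q'; case: (mealy q' cs) => q'' cs'' /= ->.
Qed.

End Mealy.

Section Passes.
Variables (S G Q : finType) (delta : Q -> cell -> Q * cell).
Variable fin : Q -> option cell.

(** On the blank behind the digits, [fin] decides whether one more cell of
    digits is appended. *)
Definition scan_right : Q -> frag S G work_sym Q :=
  loop (fun q => act (fun _ b =>
      if b is Some (Some c) then
        let: (q', c') := delta q c in
        (inl q', (Some (Some c'), Stay, MoveR, None))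
      else (inr q, (omap Some (fin q), Stay, MoveL, None)))).

Definition go_left : frag S G work_sym unit :=
  loop (fun _ : unit => act (fun _ b =>
      if b is Some None then (inr tt, (b, Stay, Stay, None))
      else (inl tt, (b, Stay, MoveL, None)))) tt.

Definition pass (q0 : Q) : frag S G work_sym Q :=
  bind (act (fun _ b => (tt, (b, Stay, MoveR, None)))) (fun _ =>
  bind (scan_right q0) (fun q => bind go_left (fun _ => ret q))).

Variables (w : seq S) (p : nat) (o : seq G).

(** The head stands on the last cell of [ds], or on the mark if [ds] is empty;
    the store lists the cells to its left starting next to the head. *)
Definition after_cells (ds : seq cell) (r : seq work_sym) : store G work_sym :=
  let l := rev (tape_of ds 0) ++ [:: Some None] in
  Store p (behead l) (head None l) r o.

Lemma go_left_runs (ds : seq cell) r :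
  runs None w go_left (after_cells ds r) tt
    (Store p [::] (Some None) (tape_of ds 0 ++ r) o).
Proof.
elim/last_ind: ds r => [|ds c IH] r.
  by apply: runs_loop_exit; apply: RunsDone; rewrite /fr_next /act_on /= cats0.
rewrite /after_cells tape_rcons rev_rcons /= cat_rcons.
apply: runs_loop_next (IH _).
by apply: RunsDone; rewrite /fr_next /act_on /= cats0.
Qed.

Lemma scan_right_runs q0 cs e (ds : seq cell) : e <= 1 ->
  let: (q, cs') := mealy delta q0 cs in
  exists2 e', e' <= 1 &
  runs None w (scan_right q0)
    (Store p (rev (tape_of ds 0) ++ [:: Some None]) (head None (tape_of cs e))
       (behead (tape_of cs e)) o) q
    (after_cells (ds ++ cs') (tape_of (seq_of_opt (fin q)) e')).
Proof.
move=> le_e1; elim: cs q0 ds => [|c cs IH] q ds /=.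
  exists (~~ (fin q)); first by case: (fin q).
  have h0 : head None (tape_of [::] e) = None by case: (e).
  have r0 : behead (tape_of [::] e) = [::] by case: (e) le_e1 => [|[]].
  apply: runs_loop_exit; apply: RunsDone.
  by rewrite h0 r0 /fr_next /act_on /= !cats0; case: (fin q).
case Ed: (delta q c) => [q' c'].
have := IH q' (rcons ds c'); case: (mealy delta q' cs) => q'' cs'' [e' he' h].
exists e' => //; rewrite cat_rcons tape_rcons rev_rcons in h.
apply: runs_loop_next h; apply: RunsDone.
by rewrite /fr_next /= Ed /act_on /= cats0.
Qed.

(** Seen from the mark, a pass applies the transducer to the list of cells. *)
Lemma pass_runs q0 cs e : e <= 1 ->
  let: (q, cs') := mealy delta q0 cs in
  exists2 e', e' <= 1 &
  runs None w (pass q0)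
    (Store p [::] (Some None) (tape_of cs e) o) q
    (Store p [::] (Some None) (tape_of (cs' ++ seq_of_opt (fin q)) e') o).
Proof.
move=> le_e1; have := scan_right_runs q0 cs [::] le_e1.
case: (mealy delta q0 cs) => q cs' [e' he' h]; exists e' => //.
apply: (runs_bind (s' := Store p [:: Some None] (head None (tape_of cs e))
                           (behead (tape_of cs e)) o) (a := tt)).
  by apply: RunsDone; rewrite /fr_next /act_on /= cats0.
apply: (runs_bind h); apply: (runs_bind (go_left_runs _ _)).
rewrite [tape_of (cs' ++ _) _](_ : _ = tape_of ([::] ++ cs') 0 ++
  tape_of (seq_of_opt (fin q)) e'); first exact: runs_ret.
by rewrite /tape_of map_cat cats0 -catA.
Qed.

End Passes.
End Tracks.

Arguments pass {R S G Q} delta fin q0.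

Section Registers.
Variables (S G R : finType).

Record memory := Memory { m_pos : nat; m_reg : {ffun R -> nat}; m_out : seq G }.

Definition prog (A : finType) := frag S G (work_sym R) A.

Variables (w : seq S) (W : nat).

(** Between operations the work head is on the mark. The bound [W] on the number
    of digit cells is the only record of space. *)
Definition rep (s : memory) (t : store G (work_sym R)) :=
  exists cs e, [/\ t = Store (m_pos s) [::] (Some None) (tape_of cs e) (m_out s),
    e <= 1, size cs <= W & forall j, value cs j = m_reg s j].

(** Total correctness: the fragment terminates from every store representing
    [s] and ends in a store representing a memory allowed by [Post]. *)
Definition wp (A : finType) (p : prog A) (s : memory) (Post : A -> memory -> Prop) :=
  forall t, rep s t -> exists a s' t',
    [/\ runs None w p t a t', rep s' t' & Post a s'].

Lemma wp_conseq (A : finType) (p : prog A) s (P P' : A -> memory -> Prop) :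
  wp p s P -> (forall a s', P a s' -> P' a s') -> wp p s P'.
Proof.
move=> h PP' t /h [a [s' [t' [r rp pa]]]].
by exists a, s', t'; split => //; apply: PP'.
Qed.

Lemma wp_bind (A A' : finType) (p : prog A) (k : A -> prog A') s P :
  wp p s (fun a s' => wp (k a) s' P) -> wp (bind p k) s P.
Proof.
move=> h t /h [a [s1 [t1 [r1 rp1 ha]]]].
have [a' [s2 [t2 [r2 rp2 ha']]]] := ha _ rp1.
by exists a', s2, t2; split => //; apply: runs_bind r1 r2.
Qed.

(** One round of the loop; termination comes from the induction in which this
    rule is used. *)
Lemma wp_loop (A A' : finType) (f : A -> prog (A + A')%type) a s P :
  wp (f a) s (fun r s' => match r with
                          | inl a' => wp (loop f a') s' P
                          | inr a' => P a' s'
                          end) ->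
  wp (loop f a) s P.
Proof.
move=> h t /h [[a'|a'] [s1 [t1 [r1 rp1 ha]]]]; last first.
  by exists a', s1, t1; split => //; apply: runs_loop_exit r1.
have [a2 [s2 [t2 [r2 rp2 ha']]]] := ha _ rp1.
by exists a2, s2, t2; split => //; apply: runs_loop_next r1 r2.
Qed.

Definition read_letter : prog (option S) :=
  act (fun x b => (if x is Letter a then Some a else None, (b, Stay, Stay, None))).

Definition at_left : prog bool :=
  act (fun x b => (if x is LeftEnd then true else false, (b, Stay, Stay, None))).

Definition move_in (mv : move) : prog unit :=
  act (fun _ b => (tt, (b, mv, Stay, None))).

Definition emit (g : G) : prog unit :=
  act (fun _ b => (tt, (b, Stay, Stay, Some g))).

Lemma wp_ret (A : finType) (a : A) s (P : A -> memory -> Prop) :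
  P a s -> wp (ret a) s P.
Proof. by move=> h t rt; exists a, s, t; split => //; apply: runs_ret. Qed.

Lemma wp_read_letter s (P : option S -> memory -> Prop) :
  P (if m_pos s is i.+1 then onth w i else None) s -> wp read_letter s P.
Proof.
move=> h _ [cs [e [-> he hs hv]]].
exists (if m_pos s is i.+1 then onth w i else None), s.
eexists; split => //.
  apply: runs_act; rewrite /= /read_input; case: (m_pos s) => [//|i].
  by case: (onth w i).
by exists cs, e; rewrite /act_on /= cats0.
Qed.

Lemma wp_at_left s (P : bool -> memory -> Prop) :
  P (m_pos s == 0) s -> wp at_left s P.
Proof.
move=> h _ [cs [e [-> he hs hv]]]; exists (m_pos s == 0), s.
eexists; split => //.
  apply: runs_act; rewrite /= /read_input; case: (m_pos s) => [//|i].
  by case: (onth w i).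
by exists cs, e; rewrite /act_on /= cats0.
Qed.

Lemma wp_move_in mv s (P : unit -> memory -> Prop) :
  P tt (Memory (move_input (size w) mv (m_pos s)) (m_reg s) (m_out s)) ->
  wp (move_in mv) s P.
Proof.
move=> h _ [cs [e [-> he hs hv]]]; exists tt; eexists.
eexists; split => //; first by apply: runs_act.
  2: exact: h.
by exists cs, e; rewrite /act_on /= cats0.
Qed.

Lemma wp_emit g s (P : unit -> memory -> Prop) :
  P tt (Memory (m_pos s) (m_reg s) (rcons (m_out s) g)) -> wp (emit g) s P.
Proof.
move=> h _ [cs [e [-> he hs hv]]]; exists tt; eexists.
eexists; split => //; first by apply: runs_act.
  2: exact: h.
by exists cs, e; rewrite /act_on /= cats1.
Qed.

Definition upd (r : {ffun R -> nat}) (j : R) (x : nat) : {ffun R -> nat} :=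
  [ffun i => if i == j then x else r i].

Definition set_reg s j x := Memory (m_pos s) (upd (m_reg s) j x) (m_out s).

Lemma wp_pass (Q : finType) (delta : Q -> cell R -> Q * cell R) fin q0 s
    (reg' : {ffun R -> nat}) P :
  (forall cs, (forall j, value cs j = m_reg s j) -> size cs <= W ->
     let: (q, cs0) := mealy delta q0 cs in
     let cs' := cs0 ++ seq_of_opt (fin q) in
     [/\ P q (Memory (m_pos s) reg' (m_out s)), size cs' <= W &
         forall j, value cs' j = reg' j]) ->
  wp (pass delta fin q0) s P.
Proof.
move=> h _ [cs [e [-> he hs hv]]]; have := h _ hv hs.
have := @pass_runs R S G Q delta fin w (m_pos s) (m_out s) q0 cs e he.
case: (mealy delta q0 cs) => q cs' [e' he' r] [hP hW hv'].
exists q, (Memory (m_pos s) reg' (m_out s)); eexists; split => //; first exact: r.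
by eexists _, e'; split.
Qed.

Definition zero (j : R) : prog unit :=
  pass (fun q c => (q, [ffun i => (i != j) && c i])) (fun _ => None) tt.

Definition copy_reg (i j : R) : prog unit :=
  pass (fun q c => (q, [ffun k => if k == j then c i else c k]))
    (fun _ => None) tt.

(** The state of the pass is the carry; a carry left at the end opens a new
    cell. *)
Definition incr (j : R) : prog bool :=
  pass (fun q c => (q && c j, [ffun i => if i == j then q (+) c j else c i]))
    (fun q => if q then Some [ffun i => i == j] else None) true.

(** Digits come least significant first, so the last difference seen decides;
    at a difference the digit of [j] tells whether [i] is smaller. *)
Definition cmp (i j : R) : prog (option bool) :=
  pass (fun q c => (if c i == c j then q else Some (c j), c))
    (fun _ => None) None.

(** Compares one register with all registers in a single pass. *)
Definition matches (i : R) : prog {ffun R -> bool} :=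
  pass (fun (q : {ffun R -> bool}) c => ([ffun j => q j && (c j == c i)], c))
    (fun _ => None) [ffun => true].

Lemma wp_map (f : cell R -> cell R) s (reg' : {ffun R -> nat}) P :
  (forall cs, (forall j, value cs j = m_reg s j) ->
     forall j, value (map f cs) j = reg' j) ->
  P tt (Memory (m_pos s) reg' (m_out s)) ->
  wp (pass (fun q : unit => fun c => (q, f c)) (fun _ => None) tt) s P.
Proof.
move=> hf hP; apply: (wp_pass (reg' := reg')) => cs hv hW.
have -> : mealy (fun q : unit => fun c => (q, f c)) tt cs = (tt, map f cs).
  by elim: cs {hv hW} => //= c cs ->.
by rewrite /= cats0 size_map; split => //; apply: hf.
Qed.

Lemma wp_scan (Q : finType) (delta : Q -> cell R -> Q) q0 s P q :
  (forall cs, (forall j, value cs j = m_reg s j) -> foldl delta q0 cs = q) ->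
  P q s ->
  wp (pass (fun q c => (delta q c, c)) (fun _ => None) q0) s P.
Proof.
move=> hf hP; apply: (wp_pass (reg' := m_reg s)) => cs hv hW.
have -> : mealy (fun q c => (delta q c, c)) q0 cs = (foldl delta q0 cs, cs).
  by elim: cs q0 {hv hW hf} => //= c cs IH q0; rewrite IH.
by rewrite /= cats0 (hf _ hv); split => //; case: (s) hP.
Qed.

Lemma wp_zero j s P : P tt (set_reg s j 0) -> wp (zero j) s P.
Proof.
apply: wp_map => cs hv i; rewrite ffunE -hv.
elim: cs {hv} => [|c cs] /=; first by case: ifP.
by move=> ->; rewrite ffunE; case: eqP.
Qed.

Lemma wp_copy_reg i j s P :
  P tt (set_reg s j (m_reg s i)) -> wp (copy_reg i j) s P.
Proof.
apply: wp_map => cs hv k; rewrite ffunE -!hv.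
elim: cs {hv} => [|c cs] /=; first by case: ifP.
by move=> ->; rewrite ffunE; case: eqP.
Qed.

(** A cell is appended exactly when the new value reaches [2 ^ size cs], where
    [cs] are the cells present. As the new value is below [2 ^ W], this leaves
    at most [W] cells. *)
Lemma wp_incr j s (P : bool -> memory -> Prop) :
  m_reg s j + 1 < 2 ^ W ->
  (forall b, P b (set_reg s j (m_reg s j + 1))) -> wp (incr j) s P.
Proof.
move=> hlt hP.
apply: (wp_pass (reg' := upd (m_reg s) j (m_reg s j + 1))) => cs hv hW.
set delta := (fun q c => _).
(* The remaining carry has weight [2 ^ size cs0]. *)
have spec q cs0 : let: (q', cs') := mealy delta q cs0 in
  (forall i, i != j -> value cs' i = value cs0 i) /\
  value cs' j + 2 ^ size cs0 * q' = value cs0 j + q.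
  elim: cs0 q => [|c cs0 IH] q /=; first by rewrite mul1n.
  have := IH (q && c j); case: (mealy _ _ _) => q' cs' /= [h1 h2]; split.
    by move=> i ij; rewrite h1 // ffunE (negPf ij).
  rewrite ffunE eqxx expnS.
  by case: (q) h2 => /=; case: (c j) => /=; lia.
have := spec true cs; have := size_mealy delta true cs.
case: (mealy delta true cs) => q cs' /= sz [h1 h2].
split; first exact: hP.
  rewrite size_cat sz; case: q h2 => /= h2; last by rewrite addn0.
  rewrite addn1; move: hlt; rewrite -hv -h2 muln1 => hlt.
  by rewrite -(ltn_exp2l _ _ (leqnn 2)); apply: leq_ltn_trans hlt; rewrite leq_addl.
move=> i; rewrite value_cat ffunE; case: eqP => [->|/eqP ij].
  rewrite -hv -h2 sz; congr (_ + _ * _).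
  by case: (q) => //=; rewrite ffunE eqxx.
rewrite h1 // hv; case: (q) => /=; last by rewrite muln0 addn0.
by rewrite ffunE (negPf ij) muln0 addn0.
Qed.

Lemma wp_cmp i j s P :
  P (if m_reg s i == m_reg s j then None else Some (m_reg s i < m_reg s j)) s ->
  wp (cmp i j) s P.
Proof.
apply: (wp_scan (delta := fun q c => if c i == c j then q else Some (c j))).
move=> cs hv; rewrite -!hv.
have E q : foldl (fun q (c : cell R) => if c i == c j then q else Some (c j)) q cs =
  if value cs i == value cs j then q else Some (value cs i < value cs j).
  elim: cs q {hv} => //= c cs IH q; rewrite IH.
  have -> : (c i + (value cs i).*2 == c j + (value cs j).*2) =
            (value cs i == value cs j) && (c i == c j).
    by case: (c i); case: (c j) => /=; lia.
  have -> : (c i + (value cs i).*2 < c j + (value cs j).*2) =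
      (value cs i < value cs j) || (value cs i == value cs j) && (~~ c i && c j).
    by case: (c i); case: (c j) => /=; lia.
  by case: ltngtP => //= _; case: (c i); case: (c j).
exact: E.
Qed.

Lemma wp_matches i s P :
  P [ffun j => m_reg s j == m_reg s i] s -> wp (matches i) s P.
Proof.
apply: (wp_scan (delta := fun (q : {ffun R -> bool}) c =>
  [ffun j => q j && (c j == c i)])) => cs hv.
have E (q : {ffun R -> bool}) :
  foldl (fun (q : {ffun R -> bool}) (c : cell R) =>
           [ffun j => q j && (c j == c i)]) q cs =
  [ffun j => q j && (value cs j == value cs i)].
  elim: cs q {hv} => [|c cs IH] q /=; first by apply/ffunP => k; rewrite ffunE eqxx andbT.
  rewrite IH; apply/ffunP => k; rewrite !ffunE -andbA; congr andb.
  by case: (c k); case: (c i) => /=; lia.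
by rewrite E; apply/ffunP => k; rewrite !ffunE -!hv.
Qed.

Definition set_mark : prog unit :=
  act (fun _ _ => (tt, (Some None, Stay, Stay, None))).

End Registers.

Arguments read_letter {S G R}.
Arguments at_left {S G R}.
Arguments move_in {S G R} mv.
Arguments emit {S G R} g.
Arguments set_mark {S G R}.
Arguments zero {S G R} j.
Arguments copy_reg {S G R} i j.
Arguments incr {S G R} j.
Arguments cmp {S G R} i j.
Arguments matches {S G R} i.

(** * From MSO formulas to finite automata *)

Record dfa (T : finType) := Dfa {
  dfa_state : finType;
  dfa_init : dfa_state;
  dfa_step : dfa_state -> T -> dfa_state;
  dfa_final : pred dfa_state
}.

Definition dfa_run (T : finType) (D : dfa T) (I : Type) (t : I -> T) (s : seq I) :=
  foldl (fun q i => dfa_step q (t i)) (dfa_init D) s.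

Definition dfa_accepts (T : finType) (D : dfa T) (I : finType) (t : I -> T) :=
  dfa_final (dfa_run D t (enum I)).

Arguments dfa_accepts : simpl never.

Lemma dfa_accepts_ext (T : finType) (D : dfa T) (I : finType) (t t' : I -> T) :
  t =1 t' -> dfa_accepts D t = dfa_accepts D t'.
Proof.
move=> e; rewrite /dfa_accepts /dfa_run; congr dfa_final.
by elim: (enum I) (dfa_init D) => //= i s IH q; rewrite e IH.
Qed.

Section Constructions.
Variable T : finType.

Definition dfa_has (P : pred T) : dfa T :=
  @Dfa T bool false (fun q a => q || P a) id.

(** Accepts when a letter in [P] occurs strictly before one in [Q]: the second
    test in the step looks at the flag of the previous positions. *)
Definition dfa_before (P Q : pred T) : dfa T :=
  @Dfa T (bool * bool)%type (false, false)
    (fun q a => (q.1 || P a, q.2 || q.1 && Q a)) snd.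

Definition dfa_not (D : dfa T) : dfa T :=
  @Dfa T (dfa_state D) (dfa_init D) (@dfa_step T D)
    (fun q => ~~ dfa_final q).

Definition dfa_op (op : bool -> bool -> bool) (D E : dfa T) : dfa T :=
  @Dfa T (dfa_state D * dfa_state E)%type (dfa_init D, dfa_init E)
    (fun q a => (dfa_step q.1 a, dfa_step q.2 a))
    (fun q => op (dfa_final q.1) (dfa_final q.2)).

Definition dfa_map (T' : finType) (f : T -> T') (D : dfa T') : dfa T :=
  @Dfa T (dfa_state D) (dfa_init D) (fun q a => dfa_step q (f a))
    (@dfa_final T' D).

(** Subset construction for the automaton that guesses the boolean component of
    every letter; guesses are the indicator functions of sets of positions. *)
Definition dfa_ex (D : dfa (T * bool)%type) : dfa T :=
  @Dfa T {set dfa_state D} [set dfa_init D]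
    (fun A a => [set dfa_step p.1 (a, p.2) | p in setX A [set: bool]])
    (fun A => [exists q in A, dfa_final q]).

Lemma dfa_hasP (P : pred T) (I : finType) (t : I -> T) :
  dfa_accepts (dfa_has P) t = [exists i, P (t i)].
Proof.
rewrite /dfa_accepts /dfa_run /=.
have E s b : foldl (fun q i => q || P (t i)) b s = b || has (fun i => P (t i)) s.
  by elim: s b => [|i s IH] b /=; rewrite ?orbF // IH orbA.
rewrite E /=; apply/hasP/existsP => [[i _ h]|[i h]]; exists i => //.
by rewrite mem_enum.
Qed.

Lemma dfa_beforeP (P Q : pred T) n (t : 'I_n -> T) :
  dfa_accepts (dfa_before P Q) t =
  [exists i : 'I_n, exists j : 'I_n, [&& i < j, P (t i) & Q (t j)]].
Proof.
rewrite /dfa_accepts /dfa_run /=.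
set F := (fun q i => _).
have E s q : (foldl F q s).2 = q.2 || q.1 && has (fun j => Q (t j)) s ||
    ~~ pairwise (fun i j => ~~ (P (t i) && Q (t j))) s.
  elim: s q => [|i s IH] q /=; first by rewrite andbF !orbF.
  rewrite IH /= negb_and.
  have -> : all (fun j => ~~ (P (t i) && Q (t j))) s =
            ~~ (P (t i) && has (fun j => Q (t j)) s).
    case: (P (t i)); first by rewrite /= -all_predC.
    by apply/allP.
  by case: q.1 q.2 (P (t i)) (Q (t i)) (has _ s) => [] [] [] [] [].
rewrite E /=; apply/idP/existsP.
  case: (boolP [exists i : 'I_n, exists j : 'I_n, [&& i < j, P (t i) & Q (t j)]]).
    by move/existsP.
  move=> h /negP []; have: pairwise (relpre val ltn) (enum 'I_n).
    rewrite -pairwise_map val_enum_ord -sorted_pairwise ?iota_ltn_sorted //.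
    exact: ltn_trans.
  apply: sub_pairwise => i j /= ij; apply: contraNN h => h.
  by apply/existsP; exists i; apply/existsP; exists j; rewrite ij.
case=> i /existsP [j /and3P [ij hi hj]]; apply/negP => h.
move/(pairwiseP i) : h => /(_ i j); rewrite !inE size_enum_ord !ltn_ord.
by rewrite !nth_ord_enum hi hj => /(_ isT isT ij).
Qed.

Lemma dfa_notP (D : dfa T) (I : finType) (t : I -> T) :
  dfa_accepts (dfa_not D) t = ~~ dfa_accepts D t.
Proof. by []. Qed.

Lemma dfa_opP op (D E : dfa T) (I : finType) (t : I -> T) :
  dfa_accepts (dfa_op op D E) t = op (dfa_accepts D t) (dfa_accepts E t).
Proof.
rewrite /dfa_accepts /dfa_run /=; set F := (fun q i => _).
suff -> s q : foldl F q s = (foldl (fun q i => dfa_step q (t i)) q.1 s,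
                             foldl (fun q i => dfa_step q (t i)) q.2 s) by [].
by elim: s q => [[]|i s IH q] //=; rewrite IH.
Qed.

Lemma dfa_mapP (T' : finType) (f : T -> T') (D : dfa T') (I : finType)
    (t : I -> T) :
  dfa_accepts (dfa_map f D) t = dfa_accepts D (fun i => f (t i)).
Proof. by []. Qed.

(** Along a list of distinct positions, the states reached are those reached for
    some set: a set fitting the earlier guesses can be changed at the next
    position without disturbing them. *)
Lemma dfa_exP (D : dfa (T * bool)%type) (I : finType) (t : I -> T) :
  dfa_accepts (dfa_ex D) t =
  [exists X : {set I}, dfa_accepts D (fun i => (t i, i \in X))].
Proof.
suff E s : uniq s -> forall q, (q \in dfa_run (dfa_ex D) t s) =
    [exists X : {set I}, q == dfa_run D (fun i => (t i, i \in X)) s].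
  rewrite /dfa_accepts; apply/existsP/existsP => [[q]|[X h]].
    by rewrite E ?enum_uniq // => /andP [/existsP [X /eqP ->] h]; exists X.
  exists (dfa_run D (fun i => (t i, i \in X)) (enum I)).
  by rewrite h andbT E ?enum_uniq //; apply/existsP; exists X.
elim/last_ind: s => [|s i IH] /=.
  move=> _ q; rewrite inE; apply/idP/existsP => [h|[]//]; by exists set0.
rewrite rcons_uniq => /andP [is_ /IH{}IH] q.
rewrite /dfa_run foldl_rcons -/(dfa_run (dfa_ex D) t s) /=.
apply/imsetP/existsP.
  case=> [[q' b]]; rewrite !inE andbT IH => /existsP [X /eqP ->] -> /=.
  exists (if b then i |: X else X :\ i); rewrite foldl_rcons; apply/eqP.
  congr (dfa_step _ (_, _)); last by case: b; rewrite !inE eqxx.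
  rewrite /dfa_run.
  elim: s (dfa_init D) is_ {IH} => //= j s IHs q0.
  rewrite inE negb_or => /andP [ij /IHs ->].
  by case: (b); rewrite !inE (eq_sym j) (negPf ij).
case=> X /eqP ->; rewrite foldl_rcons.
exists (dfa_run D (fun i => (t i, i \in X)) s, i \in X) => //.
by rewrite !inE andbT IH; apply/existsP; exists X.
Qed.

End Constructions.

(** A position is guessed as a singleton: the guessed set is nonempty and no
    element of it lies strictly before another. *)
Definition dfa_ex1 (T : finType) (D : dfa (T * bool)%type) : dfa T :=
  dfa_ex (dfa_op andb D (dfa_op andb (dfa_has snd) (dfa_not (dfa_before snd snd)))).

Lemma dfa_ex1P (T : finType) (D : dfa (T * bool)%type) n (t : 'I_n -> T) :
  dfa_accepts (dfa_ex1 D) t =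
  [exists i, dfa_accepts D (fun j => (t j, i == j))].
Proof.
rewrite dfa_exP; apply/existsP/existsP.
  case=> X; rewrite dfa_opP dfa_opP dfa_hasP dfa_notP dfa_beforeP /=.
  case/and3P => h /existsP [i /= iX] hX; exists i.
  have hXi j : (j \in X) = (i == j).
    apply/idP/eqP => [jX|<-//]; apply: ord_inj.
    case: (ltngtP i j) => // ij; case/negP: hX.
      by apply/existsP; exists i; apply/existsP; exists j; apply/and3P.
    by apply/existsP; exists j; apply/existsP; exists i; apply/and3P.
  by rewrite (dfa_accepts_ext _ (t' := fun j => (t j, j \in X))) // => j; rewrite hXi.
case=> i h; exists [set i]; rewrite dfa_opP dfa_opP dfa_hasP dfa_notP dfa_beforeP.
apply/and3P; split.
- rewrite (dfa_accepts_ext _ (t' := fun j => (t j, i == j))) // => j.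
  by rewrite inE eq_sym.
- by apply/existsP; exists i; rewrite /= inE.
- apply/existsP => -[a /existsP [b]]; rewrite /= !inE => /and3P [ab /eqP ea /eqP eb].
  by rewrite ea eb ltnn in ab.
Qed.

(** What a formula with [k] position and [m] set variables sees of one
    position. *)
Definition track (S : finType) k m : finType :=
  (S * k.-tuple bool * m.-tuple bool)%type.

Definition add_pos (S : finType) k m (p : track S k m * bool) : track S k.+1 m :=
  (p.1.1.1, cons_tuple p.2 p.1.1.2, p.1.2).

Definition add_set (S : finType) k m (p : track S k m * bool) : track S k m.+1 :=
  (p.1.1.1, p.1.1.2, cons_tuple p.2 p.1.2).

Fixpoint mso_dfa (S : finType) k m (phi : mso S k m) : dfa (track S k m) :=
  match phi in mso _ k m return dfa (track S k m) with
  | MLt k m x y => dfa_before (fun a : track S k m => tnth a.1.2 x)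
                              (fun a : track S k m => tnth a.1.2 y)
  | MEq k m x y =>
      dfa_has (fun a : track S k m => tnth a.1.2 x && tnth a.1.2 y)
  | MLetter k m s x =>
      dfa_has (fun a : track S k m => tnth a.1.2 x && (a.1.1 == s))
  | MIn k m x X => dfa_has (fun a : track S k m => tnth a.1.2 x && tnth a.2 X)
  | MNot _ _ f => dfa_not (mso_dfa f)
  | MAnd _ _ f g => dfa_op andb (mso_dfa f) (mso_dfa g)
  | MOr _ _ f g => dfa_op orb (mso_dfa f) (mso_dfa g)
  | MExPos k m f => dfa_ex1 (dfa_map (@add_pos S k m) (mso_dfa f))
  | MAllPos k m f =>
      dfa_not (dfa_ex1 (dfa_map (@add_pos S k m) (dfa_not (mso_dfa f))))
  | MExSet k m f => dfa_ex (dfa_map (@add_set S k m) (mso_dfa f))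
  | MAllSet k m f =>
      dfa_not (dfa_ex (dfa_map (@add_set S k m) (dfa_not (mso_dfa f))))
  end.

Definition tracks (S : finType) (w : seq S) k m (v : k.-tuple 'I_(size w))
    (V : m.-tuple {set 'I_(size w)}) (i : 'I_(size w)) : track S k m :=
  (letter i, [tuple tnth v r == i | r < k], [tuple i \in tnth V r | r < m]).

Lemma mktuple_cons A n (a : A) (f : 'I_n -> A) (g : 'I_n.+1 -> A) :
  g ord0 = a -> (forall i, g (lift ord0 i) = f i) ->
  cons_tuple a [tuple f i | i < n] = [tuple g i | i < n.+1].
Proof.
move=> h0 hS; apply: eq_from_tnth => i; rewrite tnth_mktuple.
case: (unliftP ord0 i) => [j|] ->; first by rewrite hS tnthS tnth_mktuple.
by rewrite h0 tnth0.
Qed.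

Lemma add_posP (S : finType) (w : seq S) k m (v : k.-tuple 'I_(size w))
    (V : m.-tuple {set 'I_(size w)}) i j :
  add_pos (tracks v V j, i == j) = tracks (cons_tuple i v) V j.
Proof.
rewrite /add_pos /tracks /=; congr (_, _, _).
by apply: mktuple_cons => [|r]; rewrite ?tnth0 ?tnthS.
Qed.

Lemma add_setP (S : finType) (w : seq S) k m (v : k.-tuple 'I_(size w))
    (V : m.-tuple {set 'I_(size w)}) (X : {set 'I_(size w)}) j :
  add_set (tracks v V j, j \in X) = tracks v (cons_tuple X V) j.
Proof.
rewrite /add_set /tracks /=; congr (_, _).
by apply: mktuple_cons => [|r]; rewrite ?tnth0 ?tnthS.
Qed.

(** By induction on the formula: complements and products for the connectives,
    projection for the quantifiers. *)
Lemma mso_dfaP (S : finType) (w : seq S) k m (phi : mso S k m) v V :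
  dfa_accepts (mso_dfa phi) (tracks v V) = msat (w := w) phi v V.
Proof.
elim: phi v V => {k m} /=.
- move=> k m x y v V; rewrite dfa_beforeP; apply/existsP/idP.
    case=> i /existsP [j /and3P [ij]] /=; rewrite !tnth_mktuple.
    by move=> /eqP -> /eqP ->.
  move=> h; exists (tnth v x); apply/existsP; exists (tnth v y).
  by rewrite h /= !tnth_mktuple !eqxx.
- move=> k m x y v V; rewrite dfa_hasP; apply/existsP/eqP.
    by case=> i; rewrite /= !tnth_mktuple => /andP [/eqP -> /eqP ->].
  by move=> h; exists (tnth v x); rewrite /= !tnth_mktuple h !eqxx.
- move=> k m s x v V; rewrite dfa_hasP; apply/existsP/idP.
    by case=> i; rewrite /= !tnth_mktuple => /andP [/eqP -> ->].
  by move=> h; exists (tnth v x); rewrite /= !tnth_mktuple eqxx.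
- move=> k m x X v V; rewrite dfa_hasP; apply/existsP/idP.
    by case=> i; rewrite /= !tnth_mktuple => /andP [/eqP -> ->].
  by move=> h; exists (tnth v x); rewrite /= !tnth_mktuple eqxx.
- by move=> k m f IH v V; rewrite dfa_notP IH.
- by move=> k m f IH g IHg v V; rewrite dfa_opP IH IHg.
- by move=> k m f IH g IHg v V; rewrite dfa_opP IH IHg.
- move=> k m f IH v V; rewrite dfa_ex1P; apply: eq_existsb => i.
  by rewrite dfa_mapP -IH; apply: dfa_accepts_ext => j; apply: add_posP.
- move=> k m f IH v V; rewrite dfa_notP dfa_ex1P negb_exists.
  apply: eq_forallb => i; rewrite dfa_mapP dfa_notP negbK -IH.
  by apply: dfa_accepts_ext => j; apply: add_posP.
- move=> k m f IH v V; rewrite dfa_exP; apply: eq_existsb => X.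
  by rewrite dfa_mapP -IH; apply: dfa_accepts_ext => j; apply: add_setP.
- move=> k m f IH v V; rewrite dfa_notP dfa_exP negb_exists.
  apply: eq_forallb => X; rewrite dfa_mapP dfa_notP negbK -IH.
  by apply: dfa_accepts_ext => j; apply: add_setP.
Qed.

(** * Evaluating automata and comparing ranks in sweeps *)

Section Programs.
Variables (S G T : finType).

(** Every test is free to overwrite the three scratch registers [idx], [pos]
    and [neg], and preserves the saved registers, indexed by [T]. *)
Definition reg : finType := (option bool + T)%type.
Definition idx : reg := inl None.
Definition pos : reg := inl (Some true).
Definition neg : reg := inl (Some false).

Notation prog := (prog S G reg).
Notation memory := (memory G reg).

Definition seek_left : prog unit :=
  loop (fun _ : unit => bind at_left (fun b : bool =>
    if b then ret (inr tt)
    else bind (move_in MoveL) (fun _ => ret (inl tt)))) tt.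

(** While the body runs, [idx] holds the 0-based position of its letter; the
    input head is one further, because of the left end marker. *)
Definition sweep (Q : finType) (body : S -> Q -> prog Q) (q0 : Q) : prog Q :=
  bind seek_left (fun _ =>
  bind (zero idx) (fun _ =>
  bind (move_in MoveR) (fun _ =>
  loop (fun q => bind read_letter (fun x : option S =>
    if x is Some a then
      bind (body a q) (fun q' =>
      bind (incr idx) (fun _ =>
      bind (move_in MoveR) (fun _ => ret (inl q'))))
    else ret (inr q))) q0))).

Definition run_dfa k (D : dfa (track S k 0)) (x : 'I_k -> T) : prog bool :=
  bind (sweep (fun a q => bind (matches idx) (fun b : {ffun reg -> bool} =>
      ret (dfa_step q (a, [tuple b (inr (x r)) | r < k], [tuple]))))
    (dfa_init D)) (fun q => ret (dfa_final q)).

Definition incr_by (j : reg) (m : nat) : prog unit :=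
  iter m (fun p => bind (incr j) (fun _ => p)) (ret tt).

(** Integers are kept as differences [pos - neg] of counters that only grow. *)
Definition add_int (z : int) : prog unit :=
  match z with Posz m => incr_by pos m | Negz m => incr_by neg m.+1 end.

Section Rank.
Variable d : nat.

(** Accumulates [sg] times coordinate [i] of the prefix rank and table entry at
    the position stored in [x]. The control state is that of the source up to
    [x], and [None] beyond. *)
Definition add_rank_term (sg : int) (i : 'I_d) (A : rank_source S d)
    (tab : rs_state A -> S -> 'rV[int]_d) (x : T) : prog unit :=
  bind (sweep (fun a (oq : option (rs_state A)) =>
    if oq is Some q then
      bind (matches idx) (fun b : {ffun reg -> bool} =>
      if b (inr x) then
        bind (add_int (sg * tab q a ord0 i)%R) (fun _ => ret None)
      else bind (add_int (sg * rs_weight q a ord0 i)%R)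
             (fun _ => ret (Some (rs_step q a))))
    else ret None) (Some (rs_init A))) (fun _ => ret tt).

Definition add_rank (sg : int) (i : 'I_d) k (f : rank_fun S d k)
    (x : 'I_k -> T) : prog unit :=
  foldr (fun r p => bind (add_rank_term sg i (@rf_table _ _ _ f r) (x r))
                      (fun _ => p))
    (add_int (sg * rf_const f ord0 i)%R) (enum 'I_k).

(** The difference of two ranks is accumulated as a whole, so that neither of
    them has to be kept. *)
Definition cmp_rank (i : 'I_d) k (f : rank_fun S d k) (x : 'I_k -> T)
    k' (f' : rank_fun S d k') (x' : 'I_k' -> T) : prog (option bool) :=
  bind (zero pos) (fun _ => bind (zero neg) (fun _ =>
  bind (add_rank 1 i f x) (fun _ => bind (add_rank (-1)%R i f' x') (fun _ =>
  cmp pos neg)))).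

End Rank.

Variables (w : seq S) (W : nat).
Notation n := (size w).
Hypothesis size_lt : n < 2 ^ W.
Notation wp := (wp w W).

(** What a test leaves untouched. *)
Definition same (s s' : memory) : Prop :=
  m_out s' = m_out s /\ forall t, m_reg s' (inr t) = m_reg s (inr t).

(** The specification of a test with value [a]. *)
Definition yields (A : finType) (p : prog A) (s : memory) (a : A) :=
  wp p s (fun a' s' => a' = a /\ same s s').

Lemma same_trans s1 s2 s3 : same s1 s2 -> same s2 s3 -> same s1 s3.
Proof. by move=> [e1 h1] [e2 h2]; split=> [|t]; rewrite ?e2 ?h2. Qed.

Lemma yields_ret (A : finType) (a : A) s : yields (ret a) s a.
Proof. by apply: wp_ret. Qed.

Lemma wp_yields (A A' : finType) (p : prog A) (k : A -> prog A') s a Post :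
  yields p s a -> (forall s', same s s' -> wp (k a) s' Post) ->
  wp (bind p k) s Post.
Proof.
move=> h hk; apply: wp_bind; apply: wp_conseq h _ => _ s' [-> ss]; exact: hk.
Qed.

Lemma yields_bind (A A' : finType) (p : prog A) (k : A -> prog A') s a b :
  yields p s a -> (forall s', same s s' -> yields (k a) s' b) ->
  yields (bind p k) s b.
Proof.
move=> h hk; apply: wp_yields h _ => s' ss.
apply: wp_conseq (hk _ ss) _ => _ s2 [-> ss2]; split => //.
exact: same_trans ss ss2.
Qed.

Lemma wp_seek_left s Post :
  Post tt (Memory 0 (m_reg s) (m_out s)) -> wp seek_left s Post.
Proof.
case: s => p r o /=; elim: p => [|p IH] h; apply: wp_loop; apply: wp_bind;
  apply: wp_at_left => /=; first by apply: wp_ret.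
by apply: wp_bind; apply: wp_move_in; apply: wp_ret; apply: IH.
Qed.

Lemma onth_letter (i : 'I_n) : onth w i = Some (letter i).
Proof. by have [h _] := tnth_onth (letter i) (in_tuple w) i; apply: h. Qed.

(** Proof rule for sweeps with an invariant [I] on the position, the control
    state and the registers. The invariant must not speak of [idx], which the
    sweep itself advances. *)
Lemma wp_sweep (Q : finType) (body : S -> Q -> prog Q) q0 s
    (I : nat -> Q -> {ffun reg -> nat} -> Prop) Post :
  (forall i q r x, I i q r -> I i q (upd r idx x)) ->
  I 0 q0 (m_reg s) ->
  (forall (i : 'I_n) q r, I i q r -> r idx = i ->
     wp (body (letter i) q) (Memory i.+1 r (m_out s))
       (fun q' s' => [/\ m_pos s' = i.+1, m_out s' = m_out s,
                         m_reg s' idx = i & I i.+1 q' (m_reg s')])) ->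
  (forall q s', m_out s' = m_out s -> m_reg s' idx = n -> I n q (m_reg s') ->
     Post q s') ->
  wp (sweep body q0) s Post.
Proof.
move=> hupd h0 hbody hpost.
apply: wp_bind; apply: wp_seek_left; apply: wp_bind; apply: wp_zero.
apply: wp_bind; apply: wp_move_in => /=.
rewrite (minn_idPl _) //.
set f := (X in loop X).
suff loopP m i r q : m = n - i -> i <= n -> I i q r -> r idx = i ->
    wp (loop f q) (Memory i.+1 r (m_out s)) Post.
  by apply: (loopP n) => //; [rewrite subn0 | exact: hupd | rewrite ffunE eqxx].
elim: m i r q => [|m IH] i r q em le_in hI hi.
  have {em}ei : i = n by lia.
  apply: wp_loop; apply: wp_bind; apply: wp_read_letter.
  rewrite /= onth_default ?ei //; apply: wp_ret; apply: hpost => //=; by rewrite -ei.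
have lt_in : i < n by lia.
apply: wp_loop; apply: wp_bind; apply: wp_read_letter => /=.
rewrite (onth_letter (Ordinal lt_in)).
apply: wp_bind; apply: wp_conseq (hbody (Ordinal lt_in) q r hI hi) _.
move=> q' [p' r' o'] /= [-> -> hi' hI'].
apply: wp_bind; apply: wp_incr => [|_]; first by rewrite /= hi'; lia.
apply: wp_bind; apply: wp_move_in; apply: wp_ret => /=.
rewrite hi' addn1 (minn_idPl _); last by lia.
apply: IH; [lia | lia | exact: hupd | by rewrite ffunE eqxx].
Qed.

Lemma run_dfaP k (D : dfa (track S k 0)) (x : 'I_k -> T) (v : k.-tuple 'I_n) s :
  (forall r, m_reg s (inr (x r)) = tnth v r) ->
  yields (run_dfa D x) s (dfa_accepts D (tracks v [tuple])).
Proof.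
move=> hx; apply: wp_bind.
apply: (wp_sweep (I := fun i q r =>
  q = dfa_run D (tracks v [tuple]) (take i (enum 'I_n)) /\
  forall t, r (inr t) = m_reg s (inr t))).
- by move=> i q r y [-> h]; split => // t; rewrite ffunE /= h.
- by rewrite take0.
- move=> i q r [-> h] hi; apply: wp_bind; apply: wp_matches; apply: wp_ret.
  split => //; split => //=.
  rewrite /dfa_run (take_nth i) ?size_enum_ord // nth_ord_enum foldl_rcons.
  congr (dfa_step _ (_, _, _)); last by apply: val_inj; case: (mktuple _) => -[].
  apply: eq_from_tnth => j; rewrite !tnth_mktuple ffunE h hx hi; exact: val_eqE.
move=> q s' ho _ [-> h]; apply: wp_ret; split; last by split.
by rewrite take_oversize // size_enum_ord.
Qed.

(** [z] has been added to [pos - neg] at the price of at most [b] increments;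
    the sum [pos + neg] serves as a common bound for the two counters. *)
Definition shifted (r r' : {ffun reg -> nat}) (z : int) (b : nat) : Prop :=
  [/\ ((r' pos)%:Z - (r' neg)%:Z = (r pos)%:Z - (r neg)%:Z + z)%R,
      r' pos + r' neg <= r pos + r neg + b &
      forall t, r' (inr t) = r (inr t)].

Lemma shifted_trans r1 r2 r3 z1 z2 b1 b2 :
  shifted r1 r2 z1 b1 -> shifted r2 r3 z2 b2 ->
  shifted r1 r3 (z1 + z2)%R (b1 + b2).
Proof.
move=> [e1 l1 h1] [e2 l2 h2]; split; last by move=> t; rewrite h2 h1.
  by rewrite e2 e1 addrA.
by lia.
Qed.

Lemma wp_incr_by j m s (Post : unit -> memory -> Prop) :
  m_reg s j + m < 2 ^ W ->
  Post tt (set_reg s j (m_reg s j + m)) -> wp (incr_by j m) s Post.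
Proof.
elim: m s => [|m IH] s hlt hP /=.
  apply: wp_ret; move: hP; rewrite addn0; congr (Post _ _).
  case: s {hlt} => p r o; rewrite /set_reg /=; congr Memory.
  by apply/ffunP => i; rewrite ffunE; case: eqP => // ->.
apply: wp_bind; apply: wp_incr => [|_]; first by lia.
apply: IH; rewrite /= ffunE eqxx -addnA add1n //.
move: hP; congr (Post _ _).
by rewrite /set_reg /=; congr Memory; apply/ffunP => i; rewrite !ffunE; case: eqP.
Qed.

Lemma wp_add_int z s (Post : unit -> memory -> Prop) :
  m_reg s pos + m_reg s neg + `|z| < 2 ^ W ->
  (forall r, shifted (m_reg s) r z `|z| -> r idx = m_reg s idx ->
     Post tt (Memory (m_pos s) r (m_out s))) ->
  wp (add_int z) s Post.
Proof.
case: z => m hlt hP; apply: wp_incr_by; try lia; apply: hP; rewrite /shifted ?ffunE //.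
  by split => [||t]; rewrite ?ffunE //=; lia.
by split => [||t]; rewrite ?ffunE //=; lia.
Qed.

Section RankSpec.
Variable d : nat.

Lemma state_beforeS (A : rank_source S d) (i : 'I_n) :
  state_before A w i.+1 = rs_step (state_before A w i) (letter i).
Proof.
rewrite /state_before (take_nth (letter i)) // foldl_rcons.
by congr rs_step; rewrite [RHS](tnth_nth (letter i)).
Qed.

Lemma prefix_rank0 (A : rank_source S d) : prefix_rank A w 0 = 0%R.
Proof. by rewrite /prefix_rank big_pred0. Qed.

Lemma prefix_rankS (A : rank_source S d) (i : 'I_n) :
  prefix_rank A w i.+1 =
    (prefix_rank A w i + rs_weight (state_before A w i) (letter i))%R.
Proof.
rewrite /prefix_rank (bigD1 i) //= addrC; congr (_ + _)%R.
by apply: eq_bigl => j; rewrite ltnS ltn_neqAle -val_eqE andbC.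
Qed.

Variable M : nat.

Definition term_bounded (A : rank_source S d)
    (tab : rs_state A -> S -> 'rV[int]_d) (i : 'I_d) :=
  forall q a, `|rs_weight q a ord0 i|%N <= M /\ `|tab q a ord0 i|%N <= M.

(** Each of the [n] positions causes at most [M] increments. The invariant
    compares the accumulated sum with the prefix rank up to the position [v] of
    [x], and with the complete term beyond. *)
Lemma wp_add_rank_term sg i (A : rank_source S d)
    (tab : rs_state A -> S -> 'rV[int]_d) (x : T) (v : 'I_n) s Post :
  `|sg|%N = 1 -> term_bounded tab i -> m_reg s (inr x) = v ->
  m_reg s pos + m_reg s neg + M * n < 2 ^ W ->
  (forall s', m_out s' = m_out s ->
     shifted (m_reg s) (m_reg s') (sg *
       (prefix_rank A w v + tab (state_before A w v) (letter v)) ord0 i)%R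
       (M * n) -> Post tt s') ->
  wp (add_rank_term sg i tab x) s Post.
Proof.
move=> sg1 bd hx hlt hP; apply: wp_bind.
pose I j (oq : option (rs_state A)) r :=
  if j <= v then oq = Some (state_before A w j) /\
    shifted (m_reg s) r (sg * prefix_rank A w j ord0 i)%R (M * j)
  else oq = None /\ shifted (m_reg s) r (sg *
       (prefix_rank A w v + tab (state_before A w v) (letter v)) ord0 i)%R (M * j).
apply: (wp_sweep (I := I)).
- move=> j q r y; rewrite /I /shifted; case: ifP => _ [-> [h1 h2 h3]];
    by split => //; split => [||t]; rewrite !ffunE //= ?h3.
- rewrite /I leq0n prefix_rank0 /state_before take0 mxE mulr0 muln0.
  by split => //; split; rewrite ?addr0 ?addn0.
- move=> j q r hI hj; rewrite /I in hI *.
  have absM z : `|z|%N <= M -> `|(sg * z)%R|%N <= M by rewrite abszM sg1 mul1n.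
  have leMn k : k <= n -> M * k <= M * n by move=> h; apply: leq_mul.
  case: (leqP j v) hI => hjv [-> hs]; last first.
    apply: wp_ret; rewrite /= ltnNge ltnW //=; split => //; split => //.
    case: hs => h1 h2 h3; split => //; apply: leq_trans h2 _.
    by rewrite leq_add2l leq_mul ?leqnSn.
  have hr t : r (inr t) = m_reg s (inr t) by case: hs.
  have sum_lt z : `|z|%N <= M -> r pos + r neg + `|z| < 2 ^ W.
    case: hs => _ h2 _ hz; apply: leq_ltn_trans hlt.
    apply: (leq_trans (leq_add h2 hz)).
    by rewrite -addnA leq_add2l -mulnSr; apply: leMn.
  apply: wp_bind; apply: wp_matches; rewrite ffunE /= hr hx hj.
  case: eqP => [/ord_inj ev|/eqP ne]; last first.
    have lt_jv : j < v by rewrite ltn_neqAle eq_sym ne.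
    apply: wp_bind; apply: wp_add_int => [|r' hr' hi]; first exact/sum_lt/absM/(bd _ _).1.
    apply: wp_ret; rewrite lt_jv; split => //; first by rewrite hi.
    rewrite state_beforeS; split => //; rewrite prefix_rankS mxE mulrDr mulnSr.
    case: (shifted_trans hs hr') => h1 h2 h3; split => //.
    by apply: leq_trans h2 _; rewrite !leq_add2l; apply/absM/(bd _ _).1.
  apply: wp_bind; apply: wp_add_int => [|r' hr' hi]; first exact/sum_lt/absM/(bd _ _).2.
  apply: wp_ret; rewrite ev ltnn; split => //; first by rewrite hi.
  split => //; rewrite mxE mulrDr mulnSr.
  case: (shifted_trans hs hr') => h1 h2 h3; split => //.
  by apply: leq_trans h2 _; rewrite !leq_add2l; apply/absM/(bd _ _).2.
move=> q s' ho hi; rewrite /I leqNgt ltn_ord /= => -[_ hs].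
by apply: wp_ret; apply: hP.
Qed.

Definition rank_bounded k (f : rank_fun S d k) (i : 'I_d) :=
  `|rf_const f ord0 i|%N <= M /\
  forall r, term_bounded (@rf_table _ _ _ f r) i.

Lemma wp_add_rank sg i k (f : rank_fun S d k) (x : 'I_k -> T)
    (v : k.-tuple 'I_n) s Post :
  `|sg|%N = 1 -> rank_bounded f i ->
  (forall r, m_reg s (inr (x r)) = tnth v r) ->
  m_reg s pos + m_reg s neg + M * (k * n).+1 < 2 ^ W ->
  (forall s', m_out s' = m_out s ->
     shifted (m_reg s) (m_reg s') (sg * rank_val f v ord0 i)%R
       (M * (k * n).+1) -> Post tt s') ->
  wp (add_rank sg i f x) s Post.
Proof.
move=> sg1 [bc bt] hx hlt hP; rewrite /add_rank.
pose term r := (prefix_rank (rf_source f r) w (tnth v r) +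
    rf_table (state_before (rf_source f r) w (tnth v r)) (letter (tnth v r)))%R.
have: forall s', m_out s' = m_out s ->
     shifted (m_reg s) (m_reg s')
       (sg * (rf_const f ord0 i + \sum_(r <- enum 'I_k) term r ord0 i))%R
       (M * (size (enum 'I_k) * n).+1) -> Post tt s'.
  move=> s' ho hs; apply: hP => //; move: hs.
  by rewrite size_enum_ord big_enum /rank_val mxE summxE.
have: m_reg s pos + m_reg s neg + M * (size (enum 'I_k) * n).+1 < 2 ^ W.
  by rewrite size_enum_ord.
elim: (enum 'I_k) s hx {hlt hP} => [|r rs IH] s hx hlt hP /=.
  have hb : `|(sg * rf_const f ord0 i)%R|%N <= M by rewrite abszM sg1 mul1n.
  apply: wp_add_int => [|r' [h1 h2 h3] _].
    by apply: leq_ltn_trans hlt; rewrite mul0n muln1 leq_add2l.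
  apply: hP => //; rewrite big_nil addr0 mul0n muln1; split => //.
  by apply: leq_trans h2 _; rewrite leq_add2l.
rewrite /= in hlt hP; apply: wp_bind.
apply: (wp_add_rank_term sg1 (bt r) (hx r)).
  by apply: leq_ltn_trans hlt; rewrite leq_add2l leq_mul2l; lia.
move=> s' ho hs; apply: IH.
- by move=> r0; case: hs => _ _ ->.
- case: hs => _ h2 _; apply: leq_ltn_trans hlt.
  by rewrite mulSn -addnS mulnDr addnA leq_add2r.
move=> s2 ho2 hs2; apply: hP; first by rewrite ho2.
have := shifted_trans hs hs2.
by rewrite -mulrDr big_cons addrCA mulSn -addnS mulnDr.
Qed.

Lemma cmp_rankP i k (f : rank_fun S d k) (x : 'I_k -> T) (v : k.-tuple 'I_n)
    k' (f' : rank_fun S d k') (x' : 'I_k' -> T) (v' : k'.-tuple 'I_n) s :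
  rank_bounded f i -> rank_bounded f' i ->
  (forall r, m_reg s (inr (x r)) = tnth v r) ->
  (forall r, m_reg s (inr (x' r)) = tnth v' r) ->
  M * (k * n).+1 + M * (k' * n).+1 < 2 ^ W ->
  let a := rank_val f v ord0 i in let b := rank_val f' v' ord0 i in
  yields (cmp_rank i f x f' x') s
    (if a == b then None else Some (a < b)%R).
Proof.
move=> bf bf' hx hx' hlt a b.
apply: wp_bind; apply: wp_zero; apply: wp_bind; apply: wp_zero.
apply: wp_bind; apply: (wp_add_rank (v := v)) => //=.
- by move=> r; rewrite !ffunE /= hx.
- by rewrite !ffunE /=; lia.
move=> s1 ho1 [e1 l1 h1]; apply: wp_bind; apply: (wp_add_rank (v := v')) => //=.
- by move=> r; rewrite h1 !ffunE /= hx'.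
- move: l1; rewrite !ffunE /= add0n => l1; apply: leq_ltn_trans hlt.
  by rewrite leq_add2r.
move=> s2 ho2 [e2 l2 h2]; apply: wp_cmp.
split; last by split => [|t]; rewrite ?ho2 ?ho1 // h2 h1 !ffunE.
move: e2; rewrite e1 !ffunE /= -/a -/b; clearbody a b.
move: (m_reg s2 pos) (m_reg s2 neg) => p q e2.
have -> : (p == q) = (a == b) by lia.
by have -> : (p < q) = (a < b)%R by lia.
Qed.

End RankSpec.

End Programs.

Arguments run_dfa {S G T k} D x.
Arguments cmp_rank {S G T d} i {k} f x {k'} f' x'.

(** * The order on atoms *)

Section Lex.
Variable d : nat.
Implicit Types u v : 'rV[int]_d.

(** The lexicographic order with ties broken by [e], in the form in which it is
    decided: coordinate by coordinate, [e] being reached when all agree. *)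
Lemma lex_ltE u v (e : bool) :
  lex_lt u v || (u == v) && e =
  foldr (fun i r => if u ord0 i == v ord0 i then r else (u ord0 i < v ord0 i)%R)
    e (enum 'I_d).
Proof.
have -> : (u == v) =
    ([seq u ord0 i | i <- enum 'I_d] == [seq v ord0 i | i <- enum 'I_d]).
  apply/eqP/eqP => [-> //|/eq_in_map h]; apply/rowP => i.
  by apply: h; rewrite mem_enum.
have -> : lex_lt u v = ([seq u ord0 i | i <- enum 'I_d] <
    [seq v ord0 i | i <- enum 'I_d] :> seqlexi int)%O by [].
elim: (enum _) => [|i s IH] /=; first by [].
rewrite -IH ltxi_cons eqseq_cons.
by case: (ltgtP (u ord0 i) (v ord0 i)).
Qed.

Lemma lex_lt_irr u : lex_lt u u = false.
Proof. by rewrite /lex_lt ltxx. Qed.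

Lemma lex_lt_trans v u t : lex_lt u v -> lex_lt v t -> lex_lt u t.
Proof. exact: lt_trans. Qed.

Lemma lex_lt_total u v : u != v -> lex_lt u v || lex_lt v u.
Proof.
move=> ne; rewrite /lex_lt -neq_lt; apply: contraNneq ne => e.
apply/eqP/rowP => i; have := congr1 (fun t : d.-tuple int => tnth t i) e.
by rewrite !tnth_mktuple.
Qed.

End Lex.

Section Minimum.
Variables (T : eqType) (E : pred T) (lt : rel T).

Definition keep_min (best : option T) (a : T) : option T :=
  if E a && (if best is Some b then lt a b else true) then Some a else best.

Lemma fold_keep_min_none L : {in L, forall a, ~~ E a} ->
  foldl keep_min None L = None.
Proof.
elim: L => //= a L IH h; rewrite /keep_min (negPf (h a _)) ?mem_head //=.
by apply: IH => b bL; apply: h; rewrite inE bL orbT.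
Qed.

(** Once the minimum has been met it stays, and it replaces any other eligible
    value, so the order of enumeration is irrelevant. *)
Lemma fold_keep_min m L :
  E m -> m \in L -> (forall a, E a -> a != m -> lt m a && ~~ lt a m) ->
  ~~ lt m m -> foldl keep_min None L = Some m.
Proof.
move=> Em mL hm irr.
have stay s : foldl keep_min (Some m) s = Some m.
  elim: s => //= a s IH; rewrite /keep_min; case: ifP => // /andP [Ea lam].
  have [e|ne] := eqVneq a m; first by move: lam irr; rewrite e => ->.
  by case/andP: (hm a Ea ne) => _; rewrite lam.
suff gen best : (if best is Some b then E b else true) ->
    foldl keep_min best L = Some m by exact: gen.
elim: L best mL => //= a L IH best; rewrite inE => /predU1P [<-|mL] Eb.
  rewrite {2}/keep_min Em /=; case: best Eb => [b|] // Eb.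
  have [->|ne] := eqVneq b m; first by rewrite if_same stay.
  by case/andP: (hm b Eb ne) => -> _; apply: stay.
by apply: IH => //; rewrite /keep_min; case: ifP => // /andP [].
Qed.

End Minimum.

Section Atoms.
Variables (S G : finType) (P : wrp_pres S G) (w : seq S).

Lemma prec_linear :
  strict_linear_on (@selected _ _ P w) (@prec _ _ P w).
Proof.
have [irr trans tot] := chi_linear P w; split.
- by move=> a sa; rewrite /prec lex_lt_irr eqxx /=; apply: irr.
- move=> b a c sb sa sc; rewrite /prec.
  case/orP => [lab|/andP [/eqP eab cab]]; case/orP => [lbc|/andP [/eqP ebc cbc]].
  + by rewrite (lex_lt_trans lab lbc).
  + by rewrite -ebc lab.
  + by rewrite eab lbc.
  + by rewrite eab ebc eqxx (trans _ _ _ sb sa sc cab cbc) orbT.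
- move=> a b sa sb ne; rewrite /prec (eq_sym (kappa b)).
  have [e|/lex_lt_total/orP [->|->]] := eqVneq (kappa a) (kappa b).
  + by rewrite e lex_lt_irr; apply: tot.
  + by [].
  + by rewrite !orbT.
Qed.

Lemma mem_sorted_atoms a : (a \in sorted_atoms P w) = selected a.
Proof. by rewrite mem_sort mem_enum. Qed.

Lemma sorted_atoms_pairwise : pairwise (@prec _ _ P w) (sorted_atoms P w).
Proof.
have [irr trans tot] := prec_linear.
set leT := (fun a b : atom P w => (a == b) || prec a b).
have leT_total : {in selected (w := w) (D := P) &, total leT}.
  move=> a b sa sb; rewrite /leT eq_sym; case: eqVneq => //= ne.
  by apply: tot => //; rewrite eq_sym.
have leT_trans : {in selected (w := w) (D := P) & &, transitive leT}.
  move=> b a c sb sa sc; rewrite /leT.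
  case/predU1P => [-> //|ab]; case/predU1P => [<-|bc]; first by rewrite ab orbT.
  by rewrite (trans _ _ _ sb sa sc ab bc) orbT.
have all_sel : all (@selected _ _ P w) (enum (@selected _ _ P w)).
  by apply/allP => a; rewrite mem_enum.
have all_sel' : all (@selected _ _ P w) (sorted_atoms P w) by rewrite all_sort.
have := sort_sorted_in leT_total all_sel.
rewrite (sorted_pairwise_in leT_trans all_sel') => h.
have: uniq (sorted_atoms P w) by rewrite sort_uniq enum_uniq.
elim: (sorted_atoms P w) h => //= a s IH /andP [ha /IH hs] /andP [as_ /hs ->].
rewrite andbT; apply/allP => b bs; move/allP: ha => /(_ b bs) /predU1P [e|//].
by rewrite e bs in as_.
Qed.

(** Candidates for the next atom to be written; without a current atom these are
    all selected atoms. *)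
Definition eligible (cur : option (atom P w)) (a : atom P w) :=
  selected a && (if cur is Some c then prec c a else true).

(** The atoms eligible after the last one of [s1] are those of [s2], whose head
    is their minimum because the list is sorted by [prec]. *)
Lemma next_atom s1 s2 (L : seq (atom P w)) : sorted_atoms P w = s1 ++ s2 ->
  (forall a, a \in L) ->
  let cur := if s1 is a :: s then Some (last a s) else None in
  foldl (keep_min (eligible cur) (@prec _ _ P w)) None L = ohead s2.
Proof.
move=> es Lall cur; have [irr trans tot] := prec_linear.
have mem a : (a \in s1) || (a \in s2) = selected a.
  by rewrite -mem_cat -es mem_sorted_atoms.
have := sorted_atoms_pairwise; rewrite es pairwise_cat.
case/and3P => /allrelP lt12 pw1 pw2.
have asym (a b : atom P w) : selected a -> selected b -> prec a b -> ~~ prec b a.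
  move=> sa sb ab; apply/negP => ba; have := irr a sa.
  by rewrite (trans _ _ _ sb sa sa ab ba).
have E a : eligible cur a = (a \in s2).
  rewrite /eligible /cur; case: s1 {es cur} mem lt12 pw1 => [|b s] mem lt12 pw1.
    by rewrite andbT -mem.
  have lin : last b s \in b :: s by apply: mem_last.
  apply/andP/idP => [[]|a2].
    rewrite -mem => /orP [a1|//] lt_la.
    have sl : selected (last b s) by rewrite -mem lin.
    have sa : selected a by rewrite -mem a1.
    have [e|ne] := eqVneq a (last b s).
      by move: lt_la (irr _ sl); rewrite e => ->.
    move: a1 pw1; rewrite lastI mem_rcons inE (negPf ne) /= => a1.
    rewrite pairwise_rcons => /andP [/allP/(_ a a1) al _].
    by have := asym _ _ sa sl al; rewrite lt_la.
  by rewrite -mem a2 orbT; split => //; apply: lt12.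
case: s2 es mem lt12 pw2 E => [|m s] es mem lt12 pw2 E.
  by apply: fold_keep_min_none => a _; rewrite E.
have sel2 a : a \in m :: s -> selected a by rewrite -mem => ->; rewrite orbT.
apply: fold_keep_min => //; first by rewrite E mem_head.
  move=> a; rewrite E => a2 ne.
  have lt_ma : prec m a.
    move: pw2 a2; rewrite inE (negPf ne) /= => /andP [/allP h _]; exact: h.
  by rewrite lt_ma asym // sel2 ?mem_head.
by apply: irr; apply: sel2; rewrite mem_head.
Qed.

Lemma ar_le (c : copy P) : ar c <= arity P.
Proof. exact: leq_bigmax. Qed.

Lemma card_atom_le : #|atom P w| <= #|copy P| * size w ^ arity P.
Proof.
rewrite /atom card_tagged sumnE big_map big_enum /= -sum_nat_const.
apply: leq_sum => c _; rewrite card_tuple card_ord.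
have [->|n0] := posnP (size w); last by rewrite leq_pexp2l ?ar_le.
by rewrite !exp0n ?ar_gt0 // (leq_trans (ar_gt0 c)) ?ar_le.
Qed.

Lemma wrp_map_size u : wrp_map P w = Some u ->
  size u <= #|copy P| * size w ^ arity P.
Proof.
rewrite /wrp_map; case: ifP => // _ [<-].
rewrite size_pmap; apply: leq_trans (count_size _ _) _.
rewrite size_sort -cardE; apply: leq_trans (max_card _) card_atom_le.
Qed.

End Atoms.

(** * Enumerating tuples of positions *)

Section Loops.
Variables (S G T : finType) (len : T).
Notation reg := (reg T).
Notation prog := (prog S G reg).
Notation memory := (memory G reg).

(** The register [len] is supposed to hold the length of the word. *)
Definition for_pos (A : finType) (x : T) (body : A -> prog A) (a0 : A) : prog A :=
  bind (zero (inr x : reg)) (fun _ =>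
  loop (fun a => bind (cmp (inr x : reg) (inr len)) (fun o : option bool =>
    if o == Some true then
      bind (body a) (fun a' => bind (incr (inr x : reg)) (fun _ =>
      ret (inl a')))
    else ret (inr a))) a0).

Definition for_tuples (A : finType) (xs : seq T) (body : A -> prog A) :
    A -> prog A :=
  foldr (fun x p => for_pos x p) body xs.

Fixpoint words n m : seq (seq 'I_n) :=
  if m is m'.+1 then [seq i :: t | i <- enum 'I_n, t <- words n m']
  else [:: [::]].

Lemma mem_words n (t : seq 'I_n) : t \in words n (size t).
Proof.
elim: t => //= i t IH; apply/allpairsP; exists (i, t); split => //=.
by rewrite mem_enum.
Qed.

Variables (w : seq S) (W : nat).
Notation n := (size w).
Hypothesis size_lt : n < 2 ^ W.
Notation wp := (wp w W).

(** The invariant [I] relates an abstract value, on which a round for position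
    [i] acts by [f i], to the control state and the memory. *)
Lemma wp_for_pos (X : Type) (A : finType) (x : T) (body : A -> prog A) a0 s x0
    (I : X -> A -> memory -> Prop) (f : 'I_n -> X -> X) Post :
  (forall y a s v, I y a s -> I y a (set_reg s (inr x) v)) ->
  (forall y a s, I y a s -> m_reg s (inr len) = n) ->
  (forall (i : 'I_n) y a s, I y a s -> m_reg s (inr x) = i ->
     wp (body a) s (fun a' s' => I (f i y) a' s' /\ m_reg s' (inr x) = i)) ->
  I x0 a0 s ->
  (forall a s', I (foldl (fun y i => f i y) x0 (enum 'I_n)) a s' -> Post a s') ->
  wp (for_pos x body a0) s Post.
Proof.
move=> hset hlen hbody h0 hpost; apply: wp_bind; apply: wp_zero.
have: m_reg (set_reg s (inr x) 0) (inr x) = 0 by rewrite ffunE eqxx.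
have: I x0 a0 (set_reg s (inr x) 0) by apply: hset.
move: (set_reg s _ _) => {h0}s h0 hx; set F := (X in loop X).
suff gen m i y a s1 : m = n - i -> i <= n -> m_reg s1 (inr x) = i -> I y a s1 ->
   foldl (fun y i => f i y) y (drop i (enum 'I_n)) =
   foldl (fun y i => f i y) x0 (enum 'I_n) -> wp (loop F a) s1 Post.
  by apply: (gen n 0 x0) => //; rewrite ?subn0 ?drop0.
elim: m i y a s1 => [|m IH] i y a s1 em le_in hi hI e;
    apply: wp_loop; apply: wp_bind; apply: wp_cmp;
    rewrite hi (hlen _ _ _ hI).
  have -> : i = n by lia.
  rewrite eqxx /=; apply: wp_ret; apply: hpost; rewrite -e drop_oversize //.
  by rewrite size_enum_ord; lia.
have lt_in : i < n by lia.
rewrite (ltn_eqF lt_in) lt_in eqxx.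
apply: wp_bind; apply: wp_conseq (hbody (Ordinal lt_in) _ _ _ hI hi) _.
move=> a' s2 [hI2 hi2]; apply: wp_bind; apply: wp_incr => [|_].
  by rewrite hi2 /=; lia.
apply: wp_ret; apply: (IH i.+1 (f (Ordinal lt_in) y)).
- by lia.
- by lia.
- by rewrite ffunE eqxx hi2 addn1.
- exact: hset.
rewrite -e (drop_nth (Ordinal lt_in) (n := i)) ?size_enum_ord //=.
by congr (foldl _ (f _ _) _); rewrite (nth_ord_enum _ (Ordinal lt_in)).
Qed.

(** The nested loops act on the abstract value like a fold over all tuples. The
    invariant must not speak of the loop registers. *)
Lemma wp_for_tuples (X : Type) (A : finType) (xs : seq T) (body : A -> prog A) a0 s x0
    (I : X -> A -> memory -> Prop) (f : seq 'I_n -> X -> X) Post :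
  uniq xs ->
  (forall y a s x v, x \in xs -> I y a s -> I y a (set_reg s (inr x) v)) ->
  (forall y a s, I y a s -> m_reg s (inr len) = n) ->
  (forall t y a s, I y a s -> [seq m_reg s (inr x) | x <- xs] = map val t ->
     wp (body a) s (fun a' s' => I (f t y) a' s' /\
       [seq m_reg s' (inr x) | x <- xs] = map val t)) ->
  I x0 a0 s ->
  (forall a s', I (foldl (fun y t => f t y) x0 (words n (size xs))) a s' ->
     Post a s') ->
  wp (for_tuples xs body a0) s Post.
Proof.
elim: xs a0 s x0 I f Post => [|x xs IH] a0 s x0 I f Post /=.
  move=> _ _ _ hbody h0 hpost; apply: wp_conseq (hbody [::] _ _ _ h0 erefl) _.
  by move=> a s' [h _]; apply: hpost.
case/andP => x_xs uxs hset hlen hbody h0 hpost.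
apply: (wp_for_pos (x0 := x0) (I := I)
  (f := fun i y => foldl (fun y t => f (i :: t) y) y (words n (size xs)))) h0 _.
- by move=> y a s1 v; apply: hset; apply: mem_head.
- exact: hlen.
- move=> i y a s1 hI hi.
  apply: (IH _ _ y (fun y a s => I y a s /\ m_reg s (inr x) = i)
            (fun t => f (i :: t))) => //.
  + move=> y' a' s' x' v x'xs [hI' hi']; split.
      by apply: hset => //; rewrite inE x'xs orbT.
    rewrite ffunE hi'; case: eqP => // -[e].
    by rewrite e x'xs in x_xs.
  + by move=> y' a' s' [/hlen].
  + move=> t y' a' s' [hI' hi'] ht.
    apply: wp_conseq (hbody (i :: t) _ _ _ hI' _) _; first by rewrite /= hi' ht.
    by move=> a2 s2 [? [-> ->]].
- move=> a s' hI; apply: hpost; move: hI; congr (I _ _ _).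
  elim: (enum 'I_n) x0 => //= i js IHi y; rewrite IHi foldl_cat.
  by congr foldl; elim: (words _ _) y => //= t ts IHt y; rewrite IHt.
Qed.

End Loops.

(** * The evaluator *)

Section Evaluator.
Variables (S G : finType) (P : wrp_pres S G).

(** A slot holds the positions of one atom; its copy name is kept in the control
    state, being one of finitely many. *)
Definition slot : finType := option bool.
Definition current : slot := None.
Definition best : slot := Some true.
Definition candidate : slot := Some false.

(** The index type of the positions is taken one larger than the arity because
    [inord] needs a nonempty ordinal type; [None] is for the length of the word. *)
Definition saved : finType := option (slot * 'I_(arity P).+1).
Definition len : saved := None.
Notation reg := (reg saved).
Notation prog := (prog S G reg).
Notation memory := (memory G reg).

Definition at_slot (z : slot) (r : nat) : saved := Some (z, inord r).

Definition ask k (phi : mso S k 0) (x : 'I_k -> saved) : prog bool :=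
  run_dfa (mso_dfa phi) x.

Definition both (z z' : slot) k k' (r : 'I_(k + k')) : saved :=
  match split r with inl r => at_slot z r | inr r => at_slot z' r end.

Definition ask_prec (c c' : copy P) (z z' : slot) : prog bool :=
  foldr (fun i p =>
      bind (cmp_rank i (wp_rank c) (at_slot z) (wp_rank c') (at_slot z'))
        (fun o : option bool => if o is Some b then ret b else p))
    (ask (ord_formula c c') (@both z z' _ _)) (enum 'I_(wp_dim P)).

Definition copy_slot (z z' : slot) (k : nat) : prog unit :=
  foldr (fun r p => bind (copy_reg (inr (at_slot z r) : reg)
                            (inr (at_slot z' r))) (fun _ => p))
    (ret tt) (iota 0 k).

(** One step [keep_min] of the search for a minimum. The arguments [cur], [c]
    and [b] are the copy names of the current, candidate and best atoms. *)
Definition consider (cur : option (copy P)) (c : copy P) (b : option (copy P)) :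
    prog (option (copy P)) :=
  bind (ask (sel_formula c) (at_slot candidate)) (fun x : bool =>
  if ~~ x then ret b else
  bind (if cur is Some c0 then ask_prec c0 c current candidate
        else ret true) (fun x : bool =>
  if ~~ x then ret b else
  bind (if b is Some c1 then ask_prec c c1 candidate best
        else ret true) (fun x : bool =>
  if ~~ x then ret b else
  bind (copy_slot candidate best (ar c)) (fun _ => ret (Some c))))).

Definition search (cur : option (copy P)) : prog (option (copy P)) :=
  foldl (fun p c => bind p
      (for_tuples len [seq at_slot candidate r | r <- iota 0 (ar c)]
         (consider cur c)))
    (ret None) (enum (copy P)).

(** Writes the first label that applies, which is what [label] picks. *)
Definition emit_label (c : copy P) : prog unit :=
  foldr (fun g p => bind (ask (lab_formula c g) (at_slot best))
      (fun x : bool => if x then emit g else p))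
    (ret tt) (enum G).

Definition main_loop : prog unit :=
  loop (fun cur => bind (search cur) (fun b : option (copy P) =>
    if b is Some c then
      bind (emit_label c) (fun _ =>
      bind (copy_slot best current (ar c)) (fun _ => ret (inl (Some c))))
    else ret (inr tt))) None.

(** The initial sweep does nothing but count, which leaves the length in
    [idx]. *)
Definition evaluator : prog bool :=
  bind (sweep (fun _ (q : unit) => ret q) tt) (fun _ =>
  bind (copy_reg (idx saved) (inr len)) (fun _ =>
  bind (ask (dom_formula P) (at_slot candidate)) (fun x : bool =>
  if ~~ x then ret false else
  bind main_loop (fun _ => ret true)))).

Variables (w : seq S) (W M : nat).
Notation n := (size w).
Hypothesis rank_le : forall (c : copy P) i, rank_bounded M (wp_rank c) i.
Hypothesis load_lt : 2 * M * (arity P * n).+1 < 2 ^ W.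
Hypothesis size_lt : n < 2 ^ W.
Notation wp := (wp w W).
Notation yields := (yields w W).

Definition stored (z : slot) (a : atom P w) (s : memory) :=
  forall r : 'I_(ar (tag a)),
    m_reg s (inr (at_slot z r)) = tnth (tagged a) r.

Lemma stored_same z a s s' : same s s' -> stored z a s -> stored z a s'.
Proof. by move=> [_ h] ha r; rewrite h ha. Qed.

Lemma at_slot_inj z z' c (r : 'I_(ar (p := P) c)) c' (r' : 'I_(ar (p := P) c')) :
  at_slot z r = at_slot z' r' -> z = z' /\ r = r' :> nat.
Proof.
move=> [-> /(congr1 val)]; rewrite /= !inordK // ltnS;
  exact: leq_trans (ltnW (ltn_ord _)) (ar_le _).
Qed.

Lemma askP (a : atom P w) z s (phi : mso S (ar (tag a)) 0) : stored z a s ->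
  yields (ask phi (at_slot z)) s (holds phi (tagged a)).
Proof. by move=> ha; rewrite /holds -mso_dfaP; apply: run_dfaP. Qed.

Lemma ask_precP (a b : atom P w) z z' s : stored z a s -> stored z' b s ->
  yields (ask_prec (tag a) (tag b) z z') s (prec a b).
Proof.
move=> ha hb; rewrite /prec lex_ltE /ask_prec.
elim: (enum _) s ha hb => [|i l IH] s ha hb /=.
  rewrite /chi /holds -mso_dfaP; apply: run_dfaP => // r; rewrite /both.
  rewrite -[in RHS](splitK r); case: (split r) => {}r /=.
    by rewrite ha tnth_lshift.
  by rewrite hb tnth_rshift.
apply: (yields_bind (a := if kappa a ord0 i == kappa b ord0 i then None
                          else Some (kappa a ord0 i < kappa b ord0 i)%R)).
  apply: (cmp_rankP size_lt (rank_le _ _) (rank_le _ _) ha hb).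
  apply: leq_ltn_trans load_lt; rewrite -mulnDr -mulnA mulnCA leq_mul2l.
  apply/orP; right; rewrite mul2n -addnn.
  by apply: leq_add; rewrite ltnS leq_mul2r ar_le orbT.
move=> s' ss; case: eqP => _; last exact: yields_ret.
by apply: IH; [apply: stored_same ha | apply: stored_same hb].
Qed.

(** Positions are copied register by register; the general form of the
    induction describes all saved registers after copying a part of them. *)
Lemma wp_copy_slot z z' (a : atom P w) s Post : z != z' -> stored z a s ->
  (forall s', m_out s' = m_out s -> stored z' a s' ->
     (forall t, (if t is Some (y, _) then y != z' else true) ->
        m_reg s' (inr t) = m_reg s (inr t)) -> Post tt s') ->
  wp (copy_slot z z' (ar (tag a))) s Post.
Proof.
move=> zz' ha hP; rewrite /copy_slot.
have: forall s', m_out s' = m_out s ->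
   (forall t, m_reg s' (inr t) =
      m_reg s (inr (if t is Some (y, j) then
        if (y == z') && (j \in map inord (iota 0 (ar (tag a)))) then Some (z, j)
        else t else t))) -> Post tt s'.
  move=> s' ho h; apply: hP => //.
    move=> r; rewrite h /at_slot eqxx map_f ?mem_iota ?add0n ?ltn_ord //; exact: ha.
  by move=> [[y j]|] //= /negPf ne; rewrite h ne.
elim: (iota 0 _) s {ha hP} => [|r l IH] s hP.
  apply: wp_ret; apply: hP => // -[[y j]|] //=; by rewrite andbF.
apply: wp_bind; apply: wp_copy_reg; apply: IH => s' ho h; apply: hP => //.
move=> t; rewrite h !ffunE; case: t => [[y j]|] //=.
rewrite inE; have [->|ne] := eqVneq y z'; last first.
  by case: eqP => // -[e]; rewrite e eqxx in ne.
case: (j \in [seq inord i | i <- l]) => /=; rewrite ?orbT ?orbF.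
  by case: eqP => // -[e]; rewrite e eqxx in zz'.
rewrite /at_slot; have [->|ne] := eqVneq j (inord r); first by rewrite eqxx.
by case: eqP => // -[e]; rewrite e eqxx in ne.
Qed.

(** The memory during a search with current atom [cur] and best atom so far
    [b]. *)
Definition holding (o : seq G) (cur : option (atom P w)) (b : option (atom P w))
    (q : option (copy P)) (s : memory) : Prop :=
  [/\ q = omap tag b, m_out s = o, m_reg s (inr len) = n,
      (if cur is Some a then stored current a s else True) &
      (if b is Some a then stored best a s else True)].

Lemma holding_same o cur b q s s' : same s s' -> holding o cur b q s ->
  holding o cur b q s'.
Proof.
move=> ss [-> eo el hc hb]; have [ho h] := ss; split => //.
- by rewrite ho.
- by rewrite h.
- by case: (cur) hc => // a; apply: stored_same.
- by case: (b) hb => // a; apply: stored_same.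
Qed.

Notation pick_min cur := (keep_min (eligible cur) (@prec _ _ P w)).

Lemma considerP o cur b q s (a : atom P w) :
  holding o cur b q s -> stored candidate a s ->
  wp (consider (omap tag cur) (tag a) q) s
    (fun q' s' => holding o cur (pick_min cur b a) q' s' /\ stored candidate a s').
Proof.
move=> hs hc; rewrite /consider /keep_min /eligible.
apply: (wp_yields (askP _ hc)) => s1 ss1.
have {}hs := holding_same ss1 hs; have {}hc := stored_same ss1 hc.
rewrite -/(selected a); case: (selected a) => /=; last by apply: wp_ret.
apply: (wp_yields (a := if cur is Some c then prec c a else true)).
  case: cur hs => [c|] hs /=; last exact: yields_ret.
  by apply: ask_precP; case: hs.
move=> s2 ss2; have {}hs := holding_same ss2 hs; have {}hc := stored_same ss2 hc.
case: (if cur is Some _ then _ else _) => /=; last by apply: wp_ret.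
apply: (wp_yields (a := if b is Some c then prec a c else true)).
  case: b hs => [c|] [-> _ _ _ hb] /=; last exact: yields_ret.
  exact: ask_precP.
move=> s3 ss3; have {}hs := holding_same ss3 hs; have {}hc := stored_same ss3 hc.
case: (if b is Some _ then _ else _) => /=; last by apply: wp_ret.
apply: wp_bind; apply: (wp_copy_slot _ hc) => // s4 ho4 hb4 hk4.
case: hs => _ eo el hcur _; apply: wp_ret; split; last first.
  by move=> r; rewrite hk4 // hc.
split => //; first by rewrite ho4.
  by rewrite hk4.
by case: (cur) hcur => // c h r; rewrite hk4 // h.
Qed.

Definition atoms_of (c : copy P) : seq (atom P w) :=
  pmap (fun t => omap (fun v : (ar c).-tuple 'I_n =>
                  Tagged (fun c : copy P => (ar c).-tuple 'I_n) v) (insub t))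
    (words n (ar c)).

Definition all_atoms : seq (atom P w) := flatten [seq atoms_of c | c <- enum (copy P)].

Lemma mem_all_atoms a : a \in all_atoms.
Proof.
case: a => c v; apply/flatten_mapP; exists c; first by rewrite mem_enum.
rewrite mem_pmap; apply/mapP; exists (val v); last by rewrite valK.
by have := mem_words (val v); rewrite size_tuple.
Qed.

Lemma wp_for_candidates o cur b q s c Post :
  holding o cur b q s ->
  (forall q' s', holding o cur (foldl (pick_min cur) b (atoms_of c)) q' s' ->
     Post q' s') ->
  wp (for_tuples len [seq at_slot candidate r | r <- iota 0 (ar c)]
         (consider (omap tag cur) c) q) s Post.
Proof.
move=> hs hP.
apply: (wp_for_tuples size_lt (x0 := b) (I := fun b q s => holding o cur b q s)
  (f := fun t b =>
     if (insub t : option ((ar c).-tuple 'I_n)) is Some v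
     then pick_min cur b (Tagged (fun c : copy P => (ar c).-tuple 'I_n) v)
     else b)) hs _.
- rewrite map_inj_in_uniq ?iota_uniq // => r r'; rewrite !mem_iota !add0n => hr hr'.
  by case/(@at_slot_inj _ _ c (Ordinal hr) c (Ordinal hr')).
- move=> b' q' s' x v /mapP [r _ ->] [-> ho hl hc hb].
  split => //; first by rewrite ffunE.
    by case: (cur) hc => // a h r'; rewrite ffunE /= h.
  by case: (b') hb => // a h r'; rewrite ffunE /= h.
- by move=> b' q' s' [].
- move=> t b' q' s' hs' ht.
  have st : size t == ar c.
    by have /(congr1 size) := ht; rewrite !size_map size_iota => <-.
case: insubP => [v _ vt|]; last by rewrite st.
  have ev : tval v = t by [].
  pose a : atom P w := Tagged (fun c : copy P => (ar c).-tuple 'I_n) v.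
  have regs s1 : stored candidate a s1 <->
      [seq m_reg s1 (inr x) | x <- [seq at_slot candidate r | r <- iota 0 (ar c)]]
        = map val t.
    rewrite -map_comp -ev; split => [h|h r].
      apply: (@eq_from_nth _ 0); rewrite !size_map size_iota ?size_tuple // => r hr.
      rewrite (nth_map 0) ?size_iota // nth_iota // add0n /=.
      rewrite (h (Ordinal hr)) (nth_map (tnth v (Ordinal hr))) ?size_tuple //.
      by congr nat_of_ord; apply: tnth_nth.
    have := congr1 (fun l => nth 0 l r) h.
    rewrite (nth_map 0) ?size_iota // nth_iota // add0n /= => ->.
    rewrite (nth_map (tnth v r)) ?size_tuple //.
    by congr nat_of_ord; rewrite [RHS](tnth_nth (tnth v r)).
  apply: wp_conseq (considerP hs' (proj2 (regs s') ht)) _ => q2 s2 [h1 h2].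
  by split => //; apply/regs.
move=> q' s'; rewrite size_map size_iota => h; apply: hP; move: h.
congr (holding _ _ _ _ _); rewrite /atoms_of.
elim: (words _ _) b => //= t ts IH b'; rewrite IH.
by case: insub.
Qed.

Lemma wp_search o cur s Post :
  holding o cur None None s ->
  (forall q' s', holding o cur (foldl (pick_min cur) None all_atoms) q' s' ->
     Post q' s') ->
  wp (search (omap tag cur)) s Post.
Proof.
move=> hs hP; rewrite /search /all_atoms.
have: wp (ret None) s (fun q s => holding o cur None q s) by apply: wp_ret.
move: (ret None) => p hp.
have {hs hp}: wp p s (fun q s' => holding o cur (foldl (pick_min cur) None [::]) q s').
  exact: hp.
have: forall q' s', holding o cur (foldl (pick_min cur) None ([::] ++
   flatten [seq atoms_of c | c <- enum (copy P)])) q' s' -> Post q' s' by [].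
move: [::] => L; elim: (enum _) p L => [|c cs IH] p L hP' hp /=.
  apply: wp_conseq hp _ => q s'; rewrite cats0 in hP'; exact: hP'.
apply: (IH _ (L ++ atoms_of c)); first by rewrite -catA.
apply: wp_bind; apply: wp_conseq hp _ => q s' h.
by apply: wp_for_candidates h _ => q' s2; rewrite foldl_cat.
Qed.

Lemma wp_emit_label (a : atom P w) s Post : stored best a s ->
  (forall s', m_out s' = m_out s ++ seq_of_opt (label a) ->
     (forall t, m_reg s' (inr t) = m_reg s (inr t)) -> Post tt s') ->
  wp (emit_label (tag a)) s Post.
Proof.
move=> ha; have -> : label a = ohead [seq g <- enum G | has_label a g].
  by rewrite /label /pick enumT.
rewrite /emit_label; elim: (enum G) s ha => [|g gs IH] s ha hP /=.
  by apply: wp_ret; apply: hP; rewrite ?cats0.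
apply: (wp_yields (askP _ ha)) => s1 ss; rewrite -/(has_label a g).
move: hP => /=; case: (has_label a g) => /= hP.
  by case: ss => ho h; apply: wp_emit; apply: hP => //=; rewrite ho cats1.
by case: (ss) => ho h; apply: IH (stored_same ss ha) _ => s' ho' h';
  apply: hP => [|t]; rewrite ?ho' ?ho // h' h.
Qed.

(** When the atoms of [s1] have been written, the search returns the head of the
    remaining list [s2]; induction on [s2]. *)
Lemma wp_main_loop s Post : m_out s = [::] -> m_reg s (inr len) = n ->
  (forall s', m_out s' = pmap (@label _ _ P w) (sorted_atoms P w) -> Post tt s') ->
  wp main_loop s Post.
Proof.
move=> ho hl hP; rewrite /main_loop; set F := (X in loop X).
suff gen s1 s2 s' : sorted_atoms P w = s1 ++ s2 ->
    let cur := if s1 is a :: s then Some (last a s) else None in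
    holding (pmap (@label _ _ P w) s1) cur None None s' ->
    wp (loop F (omap tag cur)) s' Post.
  by apply: (gen [::] (sorted_atoms P w)).
elim: s2 s1 s' => [|a s2 IH] s1 s' es cur hs; apply: wp_loop; apply: wp_bind;
    apply: wp_search hs _ => q s3;
    rewrite (next_atom es mem_all_atoms) => -[-> ho3 hl3 hc3 hb3] /=.
  by apply: wp_ret; apply: hP; rewrite ho3 es cats0.
apply: wp_bind; apply: (wp_emit_label hb3) => s4 ho4 h4; apply: wp_bind.
have hb4 : stored best a s4 by move=> r; rewrite h4 hb3.
apply: (wp_copy_slot _ hb4) => // s5 ho5 h5 hk5; apply: wp_ret.
have := IH (rcons s1 a) s5; rewrite cat_rcons => /(_ es).
have -> : (if rcons s1 a is b :: s then Some (last b s) else None) = Some a.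
  by case: (s1) => //= b s0; rewrite last_rcons.
apply; split => //; last by rewrite hk5 ?h4.
rewrite ho5 ho4 ho3 -cats1 pmap_cat /=; by case: (label a).
Qed.

Lemma evaluatorP : wp evaluator (Memory 0 [ffun=> 0] [::])
  (fun b s => if wrp_map P w is Some u then b /\ m_out s = u else ~~ b).
Proof.
apply: wp_bind.
apply: (wp_sweep size_lt (I := fun _ _ _ => True)) => //.
  by move=> i q r _ hi; apply: wp_ret.
move=> _ [p r o] /= -> hr _; apply: wp_bind; apply: wp_copy_reg.
pose r1 := upd r (inr len) (r (idx saved)).
apply: (@wp_yields _ _ _ w W _ _ _ _ _ (holds (dom_formula P) [tuple])).
  rewrite /holds -mso_dfaP; apply: run_dfaP => //; by case.
move=> s1 [ho h]; rewrite /wrp_map; case: (holds _ _) => /=; last by apply: wp_ret.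
apply: wp_bind; apply: wp_main_loop; rewrite ?ho // ?h /= ?ffunE ?eqxx //.
by move=> s' hs'; apply: wp_ret.
Qed.

End Evaluator.

(** * The machine of a presentation *)

Lemma uniform_bound (X : finType) (B : X -> nat -> Prop) :
  (forall x m m', m <= m' -> B x m -> B x m') ->
  (forall x, exists m, B x m) -> exists m, forall x, B x m.
Proof.
move=> mono /fin_all_exists [f hf]; exists (\max_x f x) => x.
exact: mono (leq_bigmax x) (hf x).
Qed.

Lemma rank_bounded_ex (S G : finType) (P : wrp_pres S G) :
  exists M, forall (c : copy P) i, rank_bounded M (wp_rank c) i.
Proof.
have tmono d (A : rank_source S d) (tab : rs_state A -> S -> 'rV[int]_d) i m m' :
    m <= m' -> term_bounded m tab i -> term_bounded m' tab i.
  by move=> le h q a; have [h1 h2] := h q a; split; apply: leq_trans le.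
have rmono d k (f : rank_fun S d k) i m m' :
    m <= m' -> rank_bounded m f i -> rank_bounded m' f i.
  move=> le [h1 h2]; split; first exact: leq_trans le.
  by move=> r; apply: tmono le (h2 r).
apply: uniform_bound => [c m m' le h i|c]; first exact: rmono le (h i).
apply: uniform_bound => [i m m'|i]; first exact: rmono.
have [m hm] : exists m, forall r, term_bounded m (@rf_table _ _ _ (wp_rank c) r) i.
  apply: uniform_bound => [r m m'|r]; first exact: tmono.
  apply: uniform_bound => [q m m' le h a|q].
    by have [h1 h2] := h a; split; apply: leq_trans le.
  apply: uniform_bound => [a m m' le [h1 h2]|a].
    by split; apply: leq_trans le.
  exists (maxn `|rs_weight q a ord0 i| `|rf_table q a ord0 i|)%N.
  by rewrite leq_maxl leq_maxr.
exists (maxn `|rf_const (wp_rank c) ord0 i| m)%N; split; first exact: leq_maxl.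
by move=> r; apply: tmono (hm r); apply: leq_maxr.
Qed.

Definition wrp_machine (S G : finType) (P : wrp_pres S G) : machine S G :=
  frag_machine None (bind (set_mark) (fun _ => evaluator P)).

(** Counters reach at most [2 * M * (arity P * n).+1] and positions at most [n],
    so [W] digits suffice for [W] the sum of [log n] and a constant; the mark and
    one trailing blank are the only further cells. *)
Lemma wrp_machine_run (S G : finType) (P : wrp_pres S G) : exists C, forall w,
  exists t, let c := run (wrp_machine P) w t in
  [/\ verdict w c = Some (isSome (wrp_map P w)),
      forall u, wrp_map P w = Some u -> c_output c = u &
      Defs.space c <= C * maxn 1 (trunc_log 2 (size w))].
Proof.
have [M hM] := rank_bounded_ex P.
(* All register contents are below [K * n.+1]. *)
pose K := (2 * M * (arity P).+1).+1.
pose a := up_log 2 K.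
have hK : K <= 2 ^ a by exact: (@up_logP 2 K isT).
pose b := maxn 1 (up_log 2 #|tm_work (wrp_machine P)|).
exists ((a + 4) * b) => w.
pose n := size w; pose W := a + (trunc_log 2 n).+1.
have hn : n.+1 <= 2 ^ (trunc_log 2 n).+1 by exact: trunc_log_ltn.
have hW : K * n.+1 <= 2 ^ W by rewrite expnD leq_mul.
have load_lt : 2 * M * (arity P * n).+1 < 2 ^ W.
  apply: leq_trans hW; apply: (@leq_trans (2 * M * ((arity P).+1 * n.+1)).+1).
    by rewrite ltnS leq_mul2l; apply/orP; right; rewrite mulnS mulSn; lia.
  by rewrite mulnA /K; lia.
have size_lt : n < 2 ^ W by apply: leq_trans hW; rewrite /K mulSn leq_addr.
pose s0 : memory G (reg (saved P)) := Memory 0 [ffun=> 0] [::].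
pose t0 : store G (work_sym (reg (saved P))) := Store 0 [::] (Some None) [::] [::].
have rep0 : rep W s0 t0.
  by exists [::], 0; split => // j; rewrite ffunE.
have [x [s [st [hrun hrep hpost]]]] := evaluatorP hM load_lt size_lt rep0.
have run0 : runs None w (set_mark)
    (Store 0 [::] None [::] [::]) tt t0 by apply: RunsDone.
have [t [hv ho hs]] := frag_machine_run
  (runs_bind (k := fun _ => evaluator P) run0 hrun).
have [cs [e [est he hcs _]]] := hrep.
exists t; split.
- by rewrite hv; move: hpost; case: (wrp_map P w) => [u [-> _]|/negPf ->].
- by move=> u eu; rewrite eu in hpost; case: hpost => _ <-; rewrite ho est.
- rewrite hs est /= add0n size_cat size_map size_nseq mulnAC leq_mul2r.
  apply/orP; right; apply: (@leq_trans (W + 2)); first by lia.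
  rewrite /W /n; move: (trunc_log 2 _) => l; rewrite /maxn; case: ltnP => h.
    by rewrite mulnDl; have := leq_mul (leqnn a) h; lia.
  by lia.
Qed.

Theorem theorem4p10 (S G : finType) (T : seq S -> option (seq G)) (k : nat)
    (P : wrp_pres S G) (hT : wrp_map P =1 T) (hk : arity P = k) :
  (exists M : machine S G, [/\ computes M T, log_space M & poly_time M]) /\
  (exists C : nat, forall (w : seq S) (u : seq G),
     T w = Some u -> size u <= C * size w ^ k).
Proof.
split; last first.
  by exists #|copy P| => w u; rewrite -hT -hk; apply: wrp_map_size.
have [C hC] := wrp_machine_run P.
have ls : log_space (wrp_machine P).
  exists C => w t; have [t' [hv _ hs]] := hC w.
  by apply: leq_trans hs; apply: space_run_halted; rewrite hv.
exists (wrp_machine P); split => //.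
  move=> w; have [t [hv ho _]] := hC w; exists t; rewrite -hT.
  by case E: (wrp_map P w) hv ho => [u|] hv ho //; split => //; apply: ho.
by apply: poly_time_of_log_space ls => w; have [t [hv _ _]] := hC w; exists t; rewrite hv.
Qed.
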